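(* Assume $T$ has NIP. Let $p(x)\in S_x(\mathfrak{C})$ be an $A$-invariant type with $x$ a $\mathfrak{C}$-small tuple of variables, and assume that the degree of saturation of $\mathfrak{C}$ is at least $\beth_{(\beth_2(|x|+|T|+|A|))^+}$. Then there exists a finest equivalence relation $E^{\mathrm{st}}$ on $p(\mathfrak{C}')$ which is relatively type-definable over a $\mathfrak{C}$-small set of parameters from $\mathfrak{C}$ and has stable quotient $p(\mathfrak{C}')/E^{\mathrm{st}}$.
   Context: $T$ is a complete first-order theory with infinite models. $\mathfrak{C}\prec\mathfrak{C}'$ are models of $T$, $\mathfrak{C}$ is $\kappa$-saturated for a strong limit $\kappa>|T|$ ($\kappa$ is the degree of saturation of $\mathfrak{C}$), and $\mathfrak{C}'$ is $\kappa'$-saturated and strongly $\kappa'$-homogeneous for a strong limit $\kappa'>|\mathfrak{C}|$; $\mathfrak{C}$-small means of cardinality $<\kappa$. $A\subseteq\mathfrak{C}$ is $\mathfrak{C}$-small; $p$ is $A$-invariant, i.e. for formulas $\varphi(x,y)$ and $b\equiv_A b'$ in $\mathfrak{C}$, $\varphi(x,b)\in p$ iff $\varphi(x,b')\in p$. An equivalence relation on $p(\mathfrak{C}')$ is relatively type-definable over $B$ if it equals $\pi(\mathfrak{C}',\mathfrak{C}')\cap p(\mathfrak{C}')^2$ for a partial type $\pi(x,y)$ over $B$. The quotient $p(\mathfrak{C}')/E$ (for $E$ relatively type-definable over a subset of $\mathfrak{C}$) is stable if for every $\mathfrak{C}$-indiscernible sequence $(a_i,b_i)_{i<\omega}$ in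 $\mathfrak{C}'$ with $a_i\in p(\mathfrak{C}')/E$ and $b_i$ tuples, $\mathrm{tp}(a_i,b_j/\mathfrak{C})=\mathrm{tp}(a_j,b_i/\mathfrak{C})$ for all $i\neq j$. *)

(* Defs.v *)
From mathcomp Require Import all_boot.
From mathcomp Require Import boolp classical_sets functions cardinality.

Set Implicit Arguments.
Unset Strict Implicit.
Unset Printing Implicit Defensive.

Local Open Scope classical_set_scope.
Local Open Scope card_scope.

(** ** Cardinals *)

Definition card_lt T U (A : set T) (B : set U) : Prop :=
  A #<= B /\ ~ (B #<= A).

Definition strong_limit (K : Type) : Prop :=
  infinite_set [set: K] /\
  forall Y : set K, card_lt Y [set: K] ->
    card_lt [set Z | Z `<=` Y] [set: K].

(** [W], ordered by [lt], is the ordinal [|L|^+]. *)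
Definition is_succ_cardinal (L W : Type) (lt : W -> W -> Prop) : Prop :=
  [/\ well_founded lt,
      forall u v w, lt u v -> lt v w -> lt u w,
      forall v w, [\/ lt v w, v = w | lt w v],
      ~ ([set: W] #<= [set: L]) &
      forall w, [set v | lt v w] #<= [set: L]].

Section Beth.
Variables (W : Type) (lt : W -> W -> Prop).

(** For [w] of rank [a], a set of cardinality [beth_a].  The cardinal
    [aleph_0 + \sum_(b < a) 2 ^ beth_b] is [beth_a] because [|a| <= beth_a]. *)
Fixpoint beth_at (w : W) (acc : Acc lt w) : Type :=
  (nat + {v : {v | lt v w} & set (beth_at (Acc_inv acc (proj2_sig v)))})%type.

(** [beth_a] for [a] the order type of [(W, lt)]. *)
Definition beth (wf : well_founded lt) : Type :=
  (nat + {w : W & set (beth_at (wf w))})%type.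

End Beth.

(** [beth_(|L|^+) <= |K|] *)
Definition beth_succ_le (L K : Type) : Prop :=
  exists (W : Type) (lt : W -> W -> Prop) (wf : well_founded lt),
    is_succ_cardinal L lt /\ [set: beth wf] #<= [set: K].

(** ** First-order logic *)

Record language := Language {
  fsym : Type;
  farity : fsym -> nat;
  rsym : Type;
  rarity : rsym -> nat
}.

Inductive term (L : language) (V : Type) : Type :=
| Var of V
| App (f : fsym L) of ('I_(farity f) -> term L V).

(** [formula L V] has its free variables in [V]; in [All phi], the bound
    variable of [phi] is [None]. *)
Inductive formula (L : language) (V : Type) : Type :=
| Bot
| Eq of term L V & term L V
| Rel (r : rsym L) of ('I_(rarity r) -> term L V)
| Imp of formula L V & formula L V
| All of formula L (option V).

Arguments Bot {L V}.

Definition Neg L V (phi : formula L V) : formula L V := Imp phi Bot.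

Definition sentence L := formula L void.

Fixpoint term_rename L V W (h : V -> W) (t : term L V) : term L W :=
  match t with
  | Var v => Var L (h v)
  | App f args => App (fun i => term_rename h (args i))
  end.

Fixpoint rename L V W (h : V -> W) (phi : formula L V) : formula L W :=
  match phi with
  | Bot => Bot
  | Eq t u => Eq (term_rename h t) (term_rename h u)
  | Rel r args => Rel (fun i => term_rename h (args i))
  | Imp phi psi => Imp (rename h phi) (rename h psi)
  | All phi => All (rename (omap h) phi)
  end.

Record structure (L : language) := Structure {
  carrier :> Type;
  carrier_inhabited : inhabited carrier;
  finterp : forall f : fsym L, ('I_(farity f) -> carrier) -> carrier;
  rinterp : forall r : rsym L, ('I_(rarity r) -> carrier) -> Prop
}.

Fixpoint eval L (M : structure L) V (v : V -> M) (t : term L V) : M :=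
  match t with
  | Var x => v x
  | App f args => finterp (fun i => eval v (args i))
  end.

Fixpoint sat L (M : structure L) V (v : V -> M) (phi : formula L V) : Prop :=
  match phi with
  | Bot => False
  | Eq t u => eval v t = eval v u
  | Rel r args => rinterp (fun i => eval v (args i))
  | Imp phi psi => sat v phi -> sat v psi
  | All phi => forall m : M, sat (fun o => if o is Some x then v x else m) phi
  end.

(** ** Theories *)

Definition models L (M : structure L) (T : set (sentence L)) : Prop :=
  forall phi, T phi -> sat (fun x : void => match x with end : M) phi.

Definition entails L (T : set (sentence L)) (phi : sentence L) : Prop :=
  forall M : structure L, models M T ->
    sat (fun x : void => match x with end : M) phi.

Definition complete_theory L (T : set (sentence L)) : Prop :=
  (exists M : structure L, models M T) /\
  forall phi, entails T phi \/ entails T (Neg phi).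

Definition has_infinite_model L (T : set (sentence L)) : Prop :=
  exists M : structure L, models M T /\ infinite_set [set: M].

Definition copair (A B M : Type) (f : A -> M) (g : B -> M) (s : A + B) : M :=
  match s with inl a => f a | inr b => g b end.

Definition has_IP L (T : set (sentence L)) m n
    (phi : formula L ('I_m + 'I_n)) : Prop :=
  exists M : structure L, models M T /\
    exists (a : nat -> 'I_m -> M) (b : set nat -> 'I_n -> M),
      forall i (I : set nat), sat (copair (a i) (b I)) phi <-> I i.

Definition NIP L (T : set (sentence L)) : Prop :=
  forall m n (phi : formula L ('I_m + 'I_n)), ~ has_IP T phi.

(** ** Models

    Formulas in variables [V] with parameters from [B] are elements of
    [formula L (V + B)]; they are evaluated by sending each parameter to
    itself. *)

Definition finitely_satisfiable L (M : structure L) V (B : Type) (par : B -> M)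
    (Gamma : set (formula L (V + B))) : Prop :=
  forall S : set (formula L (V + B)), finite_set S -> S `<=` Gamma ->
    exists a : V -> M, forall phi, S phi -> sat (copair a par) phi.

(** [M] is [|K|]-saturated. *)
Definition saturated (K : Type) L (M : structure L) : Prop :=
  forall B : set M, card_lt B [set: K] ->
    forall Gamma : set (formula L (unit + set_type B)),
      finitely_satisfiable set_val Gamma ->
      exists a : unit -> M,
        forall phi, Gamma phi -> sat (copair a set_val) phi.

Definition automorphism L (M : structure L) (sigma : M -> M) : Prop :=
  [/\ bijective sigma,
      forall (f : fsym L) (args : 'I_(farity f) -> M),
        sigma (finterp args) = finterp (sigma \o args) &
      forall (r : rsym L) (args : 'I_(rarity r) -> M),
        rinterp (sigma \o args) <-> rinterp args].

(** [M] is strongly [|K|]-homogeneous. *)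
Definition strongly_homogeneous (K : Type) L (M : structure L) : Prop :=
  forall (B : set M) (f : set_type B -> M), card_lt B [set: K] ->
    (forall n (phi : formula L 'I_n) (v : 'I_n -> set_type B),
        sat (set_val \o v) phi <-> sat (f \o v) phi) ->
    exists sigma : M -> M,
      automorphism sigma /\ forall b, sigma (set_val b) = f b.

Definition elementary_embedding L (M N : structure L) (iota : M -> N) : Prop :=
  forall n (phi : formula L 'I_n) (v : 'I_n -> M),
    sat v phi <-> sat (iota \o v) phi.

(** ** Global types *)

(** [p] is a complete type over the whole model [M], in variables [X]. *)
Definition complete_type L (M : structure L) X
    (p : set (formula L (X + M))) : Prop :=
  finitely_satisfiable id p /\ forall phi, p phi \/ p (Neg phi).

Definition same_type_over L (M : structure L) (A : set M) n
    (b b' : 'I_n -> M) : Prop :=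
  forall psi : formula L ('I_n + set_type A),
    sat (copair b set_val) psi <-> sat (copair b' set_val) psi.

(** [phi(x, b)], as a formula in variables [X] with parameters from [M] *)
Definition plug L (M : structure L) X n (b : 'I_n -> M)
    (phi : formula L (X + 'I_n)) : formula L (X + M) :=
  rename (copair inl (inr \o b)) phi.

Definition invariant_over L (M : structure L) X (A : set M)
    (p : set (formula L (X + M))) : Prop :=
  forall n (phi : formula L (X + 'I_n)) (b b' : 'I_n -> M),
    same_type_over A b b' -> (p (plug b phi) <-> p (plug b' phi)).

(** ** Relatively type-definable equivalence relations and their quotients

    [iota : M -> N] plays the role of the inclusion of [M] in [N]. *)

Section Quotients.
Variables (L : language) (M N : structure L) (iota : M -> N) (X : Type).

(** The set [p(N)]. *)
Definition realizations (p : set (formula L (X + M))) : set (X -> N) :=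
  [set a | forall phi, p phi -> sat (copair a iota) phi].

Definition equivalence_on (P : set (X -> N))
    (E : (X -> N) -> (X -> N) -> Prop) : Prop :=
  [/\ forall a b, E a b -> P a /\ P b,
      forall a, P a -> E a a,
      forall a b, E a b -> E b a &
      forall a b c, E a b -> E b c -> E a c].

Definition rel_type_definable (P : set (X -> N)) (B : set M)
    (E : (X -> N) -> (X -> N) -> Prop) : Prop :=
  exists pi : set (formula L ((X + X) + set_type B)),
    forall a b, E a b <->
      [/\ P a, P b &
          forall phi, pi phi -> sat (copair (copair a b) (iota \o set_val)) phi].

(** Elements of the quotient are the equivalence classes. *)
Definition quotient (P : set (X -> N)) (E : (X -> N) -> (X -> N) -> Prop)
    : set (set (X -> N)) :=
  [set q | exists2 a, P a & q = [set b | E a b]].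

Definition automorphism_over (sigma : N -> N) : Prop :=
  automorphism sigma /\ forall m : M, sigma (iota m) = iota m.

(** The families [(q_i, b_i)_i] and [(q'_i, b'_i)_i], with [q_i], [q'_i] in a
    quotient [p(N)/E] and [b_i], [b'_i] tuples, have the same type over [M];
    types of hyperimaginaries are orbits under the automorphisms fixing [M]. *)
Definition same_quotient_type (I Y : Type) (q : I -> set (X -> N))
    (b : I -> Y -> N) (q' : I -> set (X -> N)) (b' : I -> Y -> N) : Prop :=
  exists sigma : N -> N, automorphism_over sigma /\
    forall i, [set sigma \o a | a in q i] = q' i /\ sigma \o b i = b' i.

Definition indiscernible (Y : Type) (q : nat -> set (X -> N))
    (b : nat -> Y -> N) : Prop :=
  forall n (i j : 'I_n -> nat),
    (forall k l : 'I_n, k < l -> i k < i l) ->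
    (forall k l : 'I_n, k < l -> j k < j l) ->
    same_quotient_type (q \o i) (b \o i) (q \o j) (b \o j).

(** [P/E] is stable; the tuples [b_i] have length less than [|K'|]. *)
Definition stable_quotient (K' : Type) (P : set (X -> N))
    (E : (X -> N) -> (X -> N) -> Prop) : Prop :=
  forall (Y : Type) (q : nat -> set (X -> N)) (b : nat -> Y -> N),
    card_lt [set: Y] [set: K'] ->
    (forall i, quotient P E (q i)) ->
    indiscernible q b ->
    forall i j, i <> j ->
      same_quotient_type (fun _ : unit => q i) (fun _ => b j)
                         (fun _ : unit => q j) (fun _ => b i).

(** [E] is an equivalence relation on [P], relatively type-definable over a
    subset of [M] of cardinality less than [|K|], with stable quotient. *)
Definition stable_equivalence (K K' : Type) (P : set (X -> N))
    (E : (X -> N) -> (X -> N) -> Prop) : Prop :=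
  [/\ equivalence_on P E,
      exists B : set M, card_lt B [set: K] /\ rel_type_definable P B E &
      stable_quotient K' P E].

End Quotients.

(* Main.v *)
Require Import Defs.
From mathcomp Require Import all_boot.
From mathcomp Require Import boolp classical_sets functions cardinality filter wochoice.
From mathcomp Require Import zify.

Set Implicit Arguments.
Unset Strict Implicit.
Unset Printing Implicit Defensive.

Local Open Scope classical_set_scope.
Local Open Scope card_scope.

(** Let [P = p(C')] and [G = Aut(C'/C)].  [P] is a single [G]-orbit and all the
    relations below are [G]-invariant.  A stable relation is an intersection of
    stable relations, each of which is a chain [R_0, R_1, ...] of instances of
    formulas over [C] with [R_(k+1) o R_(k+1)] contained in [R_k].  The sequence
    [tau] of the formulas without their parameters takes few values, so it is
    enough to find, for each [tau], a small set of stable chains of shape [tau]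
    whose intersection is contained in the [R_0] of every other one.

    If there is no such set, choose along a long well-order chains [c_w] and
    points [a_w] such that [(a_w, o)] belongs to the chain [c_v] for all [v < w]
    but not to the relation [R_0] of [c_w].  By NIP, applied to products of
    elements of [G], no large finite set of indices is independent, i.e. such
    that each chain fails to contain the intersection of the others (up to a
    fixed entourage).  By the free set theorem some finite set [s] of indices
    then controls more indices than there are formulas, hence infinitely many
    of them by the same formula.  The intersection [F] of the chains in [s] is
    stable, and modulo [F] the points [a_w] order the parameters of the chains:
    this is a contradiction.  The bound on the saturation of [C] makes the
    number of chains needed bounded independently of [tau]. *)

(** * Cardinals *)

(** The parameters of the chains range over C, which is not small; only the shapes [tau] are few.
    NIP enters twice: it bounds independent sets of indices, which yields the finite set s, and it
    refutes the sequence found at the end. The second use is settled before the first: the bound N0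
    for [tau 2] fixes the level down to which s must control other chains, and only then is the
    bound N3 for independent sets known. The form of the free set theorem used here costs one power
    set per element, so the indices form an N3-fold power set of a type [Lam] with at least as many
    elements as there are formulas. As N3 depends on [tau], one needs a cardinal [Z] above all
    finite iterated power sets and with 2^Z at most kappa. Extracting an indiscernible sequence
    moves the parameters out of C, where the chain conditions may fail. The control exercised by s
    is therefore first turned into one formula by compactness, and it is this formula that is made
    constant. *)

Definition embeds (A B : Type) : Prop := exists f : A -> B, injective f.

Lemma embeds_refl A : embeds A A.
Proof. by exists id. Qed.

Lemma embeds_trans A B D : embeds A B -> embeds B D -> embeds A D.
Proof.
by move=> [f fi] [g gi]; exists (g \o f) => x y /gi /fi.
Qed.

Lemma embeds_set A B : embeds A B -> embeds (set A) (set B).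
Proof.
move=> [f fi]; exists (fun S => f @` S) => S T /seteqP[ST TS].
apply/seteqP; split => x Sx.
  have /ST[y Ty /fi <-//] : (f @` S) (f x) by exists x.
have /TS[y Ty /fi <-//] : (f @` T) (f x) by exists x.
Qed.

Lemma embeds_set1 A : embeds A (set A).
Proof. by exists (fun x => [set x]) => x y /seteqP[/(_ x) + _]; apply. Qed.

Lemma cantor A : ~ embeds (set A) A.
Proof.
move=> [f fi]; pose D := [set x | exists2 S, f S = x & ~ S x].
have [DfD|nD] := pselect (D (f D)).
  by have [S /fi ->] := DfD.
by apply: (nD); exists D.
Qed.

Lemma card_leE T U (A : set T) (B : set U) :
  (A #<= B) <-> embeds (set_type A) (set_type B).
Proof.
split; first by move=> /card_leP[f]; exists f; move=> x y; apply: inj; rewrite inE.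
move=> [f fi]; apply/card_leP.
by apply/injfunPex; exists f => // x y _ _ /fi.
Qed.

Lemma embeds_setT A : embeds (set_type [set: A]) A /\ embeds A (set_type [set: A]).
Proof.
split; first by exists val; apply: val_inj.
exists (fun x => exist _ x (mem_set I)) => x y; exact: (congr1 val).
Qed.

Lemma card_leTE A B : ([set: A] #<= [set: B]) <-> embeds A B.
Proof.
rewrite card_leE; have [A1 A2] := embeds_setT A; have [B1 B2] := embeds_setT B.
split=> AB; [apply: embeds_trans A2 _|apply: embeds_trans A1 _].
  exact: embeds_trans B1.
exact: embeds_trans B2.
Qed.

Definition small (K A : Type) : Prop := embeds A K /\ ~ embeds K A.

Lemma card_ltTE A K : card_lt [set: A] [set: K] <-> small K A.
Proof. by rewrite /card_lt !card_leTE. Qed.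

Lemma card_ltE M K (A : set M) : card_lt A [set: K] <-> small K (set_type A).
Proof.
rewrite /card_lt !card_leE; have [A1 A2] := embeds_setT K.
split=> -[B1 B2]; split.
- exact: embeds_trans A1.
- by move=> h; apply: B2; apply: embeds_trans h.
- exact: embeds_trans A2.
- by move=> h; apply: B2; apply: embeds_trans h.
Qed.

Lemma embeds_surj A B (f : A -> B) : (forall b, exists a, f a = b) -> embeds B A.
Proof.
move=> fs; have [g gf] := choice fs.
by exists g => x y xy; rewrite -(gf x) -(gf y) xy.
Qed.

(** A maximal partial injection, given by Zorn's lemma, is total or onto; otherwise one more pair
    could be added. *)
Lemma embeds_total A B : embeds A B \/ embeds B A.
Proof.
pose P := [set G : set (A * B) | (forall a b b', G (a, b) -> G (a, b') -> b = b')
   /\ (forall a a' b, G (a, b) -> G (a', b) -> a = a')].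
have [F FP Ftot|G [[Gf Gi] Gmax]] := @Zorn_bigcup _ P.
  split=> [a b b' [G1 F1 h1] [G2 F2 h2]|a a' b [G1 F1 h1] [G2 F2 h2]].
    have [/(_ _ h1)|/(_ _ h2)] := Ftot _ _ F1 F2.
      by move=> h; have [+ _] := FP _ F2; apply; [exact: h|].
    by move=> h; have [+ _] := FP _ F1; apply; [|exact: h].
  have [/(_ _ h1)|/(_ _ h2)] := Ftot _ _ F1 F2.
    by move=> h; have [_] := FP _ F2; apply; [exact: h|].
  by move=> h; have [_] := FP _ F1; apply; [|exact: h].
have [tot|/existsNP[a na]] := pselect (forall a, exists b, G (a, b)).
  have [f fG] := choice tot; left; exists f => x y xy.
  by apply: (Gi _ _ (f x)) => //; rewrite xy.
have [tot|/existsNP[b nb]] := pselect (forall b, exists a, G (a, b)).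
  have [f fG] := choice tot; right; exists f => x y xy.
  by apply: (Gf (f x)) => //; rewrite xy.
exfalso; apply: (Gmax (G `|` [set (a, b)])).
  split; first by left.
  by move=> h; apply: na; exists b; apply: h; right.
split=> [x y y'|x x' y] [h|[-> ->]] [h'|].
- exact: Gf h h'.
- by move=> [xa _]; exfalso; apply: na; exists y; rewrite -xa.
- by exfalso; apply: na; exists y'.
- by case.
- exact: Gi h h'.
- by move=> [_ yb]; exfalso; apply: nb; exists x; rewrite -yb.
- by exfalso; apply: nb; exists x'.
- by case.
Qed.

Lemma well_order_exists (W : Type) : exists lt : W -> W -> Prop,
  [/\ well_founded lt, forall x y z, lt x y -> lt y z -> lt x z &
      forall x y, [\/ lt x y, x = y | lt y x]].
Proof.
have [R Rwo] := well_ordering_principle {classic W}.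
have Rmin (D : set W) : D !=set0 ->
    exists z, [/\ D z, forall x, D x -> R z x &
      forall z', D z' -> (forall x, D x -> R z' x) -> z = z'].
  move=> [x Dx].
  have [|z [[Dz zm] zu]] := Rwo (fun x : {classic W} => `[< D x >]).
    by exists x; apply/asboolP.
  exists z; split; first by apply/asboolP.
    by move=> y Dy; apply: zm; apply/asboolP.
  by move=> z' Dz' z'm; apply: zu; split; [apply/asboolP|move=> y /asboolP; apply: z'm].
have R2 x y : R x y \/ R y x.
  have [|z [[<-|<-] zm _]] := Rmin [set x; y]; first by exists x; left.
    by left; apply: zm; right.
  by right; apply: zm; left.
have Rxx x : R x x by case: (R2 x x).
have Ra x y : R x y -> R y x -> x = y.
  move=> xy yx; have [|z [_ _ zu]] := Rmin [set x; y]; first by exists x; left.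
  have zx : z = x by apply: zu; [left|move=> _ [] ->].
  have zy : z = y by apply: zu; [right|move=> _ [] ->].
  by rewrite -zx.
have Rt x y z : R x y -> R y z -> R x z.
  move=> xy yz; have [|w [+ wm wu]] := Rmin [set t | [\/ t = x, t = y | t = z]].
    by exists x; constructor.
  case=> wE; subst w.
  - by apply: wm; constructor.
  - by rewrite -(Ra y x) //; apply: wm; constructor.
  - by rewrite (Ra y z) // in xy; apply: wm; constructor.
exists (fun x y => R x y /\ x <> y); split.
- move=> x; apply: contrapT => nx.
  have [|z [nz zm _]] := Rmin [set x | ~ Acc (fun x y => R x y /\ x <> y) x].
    by exists x.
  apply: nz; constructor => y [yz ny]; apply: contrapT => nAy.
  by apply: ny; apply: Ra => //; apply: zm.
- move=> x y z [xy nxy] [yz nyz]; split; first exact: Rt xy yz.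
  by move=> xz; apply: nxy; apply: Ra => //; rewrite xz.
- move=> x y; have [->|xy] := pselect (x = y); first by constructor.
  by have [h|h] := R2 x y; [constructor 1|constructor 3; split=> // e; apply: xy].
Qed.

(** * Classes of types closed under power sets *)

Section Ideal.
Variable Q : Type -> Prop.
Hypotheses (Q_le : forall A B, embeds A B -> Q B -> Q A)
  (Q_set : forall A, Q A -> Q (set A))
  (Q_dir : forall A B, Q A -> Q B -> exists D, [/\ Q D, embeds A D & embeds B D])
  (Q_nat : Q nat).

(** [Q] will be the class of types smaller than a strong limit, and the class of types below a
    finite iterated power set. Sums, products and sequences are coded by subsets. Here the member
    [set0] is the tag of the second summand. *)
Lemma ideal_sum A B : Q A -> Q B -> Q (A + B)%type.
Proof.
move=> QA QB; have [D [QD [f fi] [g gi]]] := Q_dir QA QB.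
apply: Q_le (Q_set (Q_set QD)).
exists (fun s => match s with inl a => [set [set f a]]
                   | inr b => [set [set g b]; set0] end).
move=> [a|b] [a'|b'] /seteqP[h1 h2].
- by have /seteqP[/(_ _ erefl)] := h1 _ erefl; move=> /fi ->.
- by have /seteqP[/(_ (f a))] := h2 set0 (or_intror erefl); move=> _ /(_ (f a) erefl).
- by have /seteqP[/(_ (f a'))] := h1 set0 (or_intror erefl); move=> _ /(_ (f a') erefl).
- have [/seteqP[/(_ _ erefl) /gi -> //]|/seteqP[/(_ _ erefl)//]] :=
    h1 _ (or_introl erefl).
Qed.

Lemma ideal_prod A B : Q A -> Q B -> Q (A * B)%type.
Proof.
move=> QA QB; apply: Q_le (Q_set (ideal_sum QA QB)).
exists (fun s => [set inl s.1; inr s.2]) => -[a b] [a' b'] /seteqP[h1 _].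
have [[->]|//] := h1 (inl a) (or_introl erefl).
by have [//|[->]] := h1 (inr b) (or_intror erefl).
Qed.

Lemma ideal_seq A : Q A -> Q (seq A).
Proof.
move=> QA; apply: Q_le (Q_set (ideal_prod Q_nat QA)).
exists (fun s => [set x | onth s x.1 = Some x.2]).
elim=> [|x s IHs] [|y t] // /seteqP[h1 h2].
- by have := h2 (0, y) erefl.
- by have := h1 (0, x) erefl.
- have /= [<-] := h1 (0, x) erefl; congr cons; apply: IHs.
  by apply/seteqP; split=> -[i z] /= h; [apply: (h1 (i.+1, z))|apply: (h2 (i.+1, z))].
Qed.

End Ideal.

Section StrongLimit.
Variables (K : Type).
Hypothesis K_sl : strong_limit K.

Lemma small_le A B : embeds A B -> small K B -> small K A.
Proof.
move=> AB [BK KB]; split; first exact: embeds_trans BK.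
by move=> h; apply: KB; apply: embeds_trans h AB.
Qed.

Lemma small_set A : small K A -> small K (set A).
Proof.
move=> [[f fi] nA]; have [_ /(_ (range f))] := K_sl.
have fY : embeds A (set_type (range f)) /\ embeds (set_type (range f)) A.
  split.
    exists (fun x => exist _ (f x) (mem_set (imageT f x))) => x y.
    by move=> /(congr1 val) /= /fi.
  apply: (embeds_surj (f := fun x => exist _ (f x) (mem_set (imageT f x)))).
  by move=> [y yY]; have [x _ xy] := set_mem yY; exists x; apply: val_inj.
rewrite !card_ltE => h.
have {h} : small K (set_type [set Z | Z `<=` range f]).
  apply: h; apply: (@small_le _ A); first by case: fY.
  by split=> //; exists f.
apply: small_le.
have sub S : (f @` S) \in [set Z | Z `<=` range f].
  by apply/mem_set => _ [x _ <-]; exists x.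
exists (fun S => SigSub (sub S)) => S T /(congr1 val) /= /seteqP[ST TS]; apply/seteqP; split=> x Sx.
  by have [|y Ty /fi <-] := ST (f x); first by exists x.
by have [|y Ty /fi <-] := TS (f x); first by exists x.
Qed.

Lemma small_dir A B : small K A -> small K B ->
  exists D, [/\ small K D, embeds A D & embeds B D].
Proof.
by case: (embeds_total A B) => h sA sB; [exists B|exists A]; split=> //; apply: embeds_refl.
Qed.

End StrongLimit.

Fixpoint pset (n : nat) (S : Type) : Type :=
  if n is m.+1 then set (pset m S) else S.

Lemma pset_le S n m : (n <= m)%N -> embeds (pset n S) (pset m S).
Proof.
elim: m => [|m IHm]; first by rewrite leqn0 => /eqP ->; apply: embeds_refl.
rewrite leq_eqVlt => /orP[/eqP ->|/IHm h]; first exact: embeds_refl.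
exact: embeds_trans h (embeds_set1 _).
Qed.

Lemma embeds_option S : embeds nat S -> embeds (option S) S.
Proof.
move=> [g gi].
pose succ x := if pselect (exists n, x = g n) is left h
  then g (projT1 (cid h)).+1 else x.
have succE n : succ (g n) = g n.+1.
  rewrite /succ; case: pselect => [h|[]]; last by exists n.
  by case: cid => m /= /gi ->.
have succN x : ~ (exists n, x = g n) -> succ x = x.
  by rewrite /succ; case: pselect.
exists (fun o => if o is Some x then succ x else g 0).
have s0 x : succ x <> g 0.
  have [[n ->]|nx] := pselect (exists n, x = g n); first by rewrite succE => /gi.
  by rewrite succN // => xg; apply: nx; exists 0.
move=> [x|] [y|] //; last 2 first.
- by move=> /s0.
- by move=> /esym /s0.
have [[n ->]|nx] := pselect (exists n, x = g n);
  have [[m ->]|ny] := pselect (exists n, y = g n).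
- by rewrite !succE => /gi [->].
- by rewrite succE succN // => h; case: ny; exists n.+1.
- by rewrite succE succN // => h; case: nx; exists m.+1.
- by rewrite !succN // => ->.
Qed.

Lemma embeds_set_sum S : embeds nat S -> embeds (set S + set S) (set S).
Proof.
move=> /embeds_option /embeds_set h; apply: embeds_trans h.
exists (fun s => match s with inl A => [set Some x | x in A]
                   | inr A => [set Some x | x in A] `|` [set None] end).
move=> [A|A] [B|B] /seteqP[AB BA].
- congr inl; apply/seteqP; split=> x xA.
    by have [|y yB [<-]] := AB (Some x); first by exists x.
  by have [|y yB [<-]] := BA (Some x); first by exists x.
- by have [] := BA None (or_intror erefl).
- by have [] := AB None (or_intror erefl).
- congr inr; apply/seteqP; split=> x xA.
    by have [|[y yB [<-]]|] := AB (Some x); first by left; exists x.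
  by have [|[y yB [<-]]|] := BA (Some x); first by left; exists x.
Qed.

(** The product is the power set of 2^S + 2^S, which embeds into 2^(S + 1) and so into 2^S. For a
    double power set this replaces the theorem that an infinite cardinal equals its square. *)
Lemma embeds_set_prod S : embeds nat S -> embeds (set (set S) * set (set S)) (set (set S)).
Proof.
move=> /embeds_set_sum /embeds_set h; apply: embeds_trans h.
exists (fun s => [set inl x | x in s.1] `|` [set inr x | x in s.2]).
move=> [A B] [A' B'] /seteqP[h1 h2]; congr pair; apply/seteqP; split=> x xA.
- by have [|[y yA [<-]]|[]] := h1 (inl x); first by left; exists x.
- by have [|[y yA [<-]]|[]] := h2 (inl x); first by left; exists x.
- by have [|[]|[y yA [<-]]] := h1 (inr x); first by right; exists x.
- by have [|[]|[y yA [<-]]] := h2 (inr x); first by right; exists x.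
Qed.

(** Regularity of a successor cardinal. If [g] were cofinal, each [w] would lie weakly below some
    [g (h w)]; the index [h w] and the place of [w] in that closed segment would embed [W] into the
    square of [set (set S)]. The value [None] stands for the end of the segment. *)
Lemma succ_cardinal_bounded S W (lt : W -> W -> Prop) I (g : I -> W) :
  embeds nat S -> is_succ_cardinal (set (set S)) lt -> embeds I (set (set S)) ->
  exists w, forall i, lt (g i) w.
Proof.
move=> natS [_ _ tri nW init] IL; apply: contrapT => nb.
apply: nW; rewrite card_leTE.
have /choice[h hP] : forall w, exists i, ~ lt (g i) w.
  move=> w; apply: contrapT => nh; apply: nb; exists w => i.
  by apply: contrapT => ni; apply: nh; exists i.
have {}init w : {f : W -> set (set S) | forall u v, lt u w -> lt v w -> f u = f v -> u = v}.
  apply: cid; have := init w; rewrite card_leE => hw.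
  have [f fi] := embeds_trans hw (embeds_setT _).1.
  pose F u := if pselect (lt u w) is left p
    then f (exist _ u (mem_set (p : [set v | lt v w] u))) else set0.
  exists F => u v uw vw; rewrite /F; case: pselect => // a; case: pselect => // b.
  by move=> /fi /(congr1 val).
have L1 : embeds (option (set (set S))) (set (set S)).
  apply: embeds_option; apply: embeds_trans natS _.
  exact: embeds_trans (embeds_set1 _) (embeds_set1 _).
have natL := embeds_set_prod natS; apply: embeds_trans natL.
have [e ei] := IL; have [o oi] := L1.
exists (fun w => (e (h w), o (if pselect (w = g (h w)) then None
   else Some (projT1 (init (g (h w))) w)))) => u v [/ei huv /oi].
rewrite -huv; case: pselect => [eu|nu]; case: pselect => [ev|nv] //.
  by move=> _; apply: etrans eu (esym ev).
move=> [].
have ult : lt u (g (h u)) by case: (tri u (g (h u))) => // /hP.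
have vlt : lt v (g (h u)).
  by move: (@hP v) nv; rewrite -huv; case: (tri v (g (h u))).
by case: init => f /= fi; apply: fi.
Qed.

Lemma inr_inj A B : injective (@inr A B).
Proof. by move=> x y []. Qed.

Lemma existT_inj I (F : I -> Type) i (x y : F i) :
  existT F i x = existT F i y -> x = y.
Proof.
move=> e; have := projT2_eq e; by rewrite (Prop_irrelevance (projT1_eq e) erefl).
Qed.

(** * The beth hierarchy and iterated power sets *)

Section BethFacts.
Variables (W : Type) (lt : W -> W -> Prop) (wf : well_founded lt).

Lemma beth_at_segment w : embeds {v | lt v w} (beth_at (wf w)).
Proof.
case: (wf w) => a /=.
exists (fun v => inr (existT (fun v : {v | lt v w} =>
  set (beth_at (a (proj1_sig v) (proj2_sig v)))) v set0)) => u v h.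
by case: h.
Qed.

Lemma beth_at_set v w : lt v w -> embeds (set (beth_at (wf v))) (beth_at (wf w)).
Proof.
move=> vw; case: (wf w) => a /=.
rewrite (Prop_irrelevance (wf v) (a v vw)).
exists (fun S => inr (existT (fun v : {v | lt v w} => set (beth_at (a (proj1_sig v) (proj2_sig v))))
  (exist _ v vw) S)) => S T e.
exact: existT_inj (inr_inj e).
Qed.

Lemma beth_at_beth w : embeds (set (beth_at (wf w))) (beth wf).
Proof.
exists (fun S => inr (existT (fun w => set (beth_at (wf w))) w S)) => S T e.
exact: existT_inj (inr_inj e).
Qed.

End BethFacts.

(** At some stage [w0] the hierarchy has passed [S]; each larger index adds a power set, and
    regularity gives a stage [w] above countably many such steps. One more power set still embeds
    into [beth wf]. *)
Lemma beth_strong_limit S K : embeds nat S -> beth_succ_le (set (set S)) K ->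
  exists Z, (forall n, embeds (pset n S) Z) /\ embeds (set Z) K.
Proof.
move=> natS [W [lt [wf [Wsucc /card_leTE bethK]]]].
have bnd := succ_cardinal_bounded _ natS Wsucc.
have [_ tr _ nW _] := Wsucc.
have [g0 g0i] : embeds (set (set S)) W.
  by case: (embeds_total (set (set S)) W) => // h; case: nW; apply/card_leTE.
have SL : embeds S (set (set S)) by apply: embeds_trans (embeds_set1 _) (embeds_set1 _).
have [w0 w0P] := bnd _ g0 (embeds_refl _).
have /choice[s sP] : forall w, exists v, lt w v.
  move=> w; have [|v vP] := bnd nat (fun=> w).
    exact: embeds_trans SL.
  by exists v; apply: (vP 0).
have [w wP] := bnd nat (fun n => iter n s w0) (embeds_trans natS SL).
have b0 n : embeds (pset n S) (beth_at (wf (iter n s w0))).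
  elim: n => [|n IHn] /=.
    apply: embeds_trans (beth_at_segment _ _); apply: embeds_trans SL _.
    by exists (fun x => exist (lt^~ w0) _ (w0P x)) => x y [] /g0i.
  by apply: embeds_trans (embeds_set IHn) (beth_at_set _ (sP _)).
exists (beth_at (wf w)); split; last exact: embeds_trans (beth_at_beth _ _) bethK.
move=> n; apply: embeds_trans (b0 n) _; apply: embeds_trans (embeds_set1 _) _.
exact: beth_at_set.
Qed.

Definition below_pset (S A : Type) : Prop := exists n, embeds A (pset n S).

Lemma below_pset_dir S A B : below_pset S A -> below_pset S B ->
  exists D, [/\ below_pset S D, embeds A D & embeds B D].
Proof.
move=> [n An] [m Bm]; exists (pset (maxn n m) S); split; first by exists (maxn n m); apply: embeds_refl.
- by apply: embeds_trans An (pset_le _ _); rewrite leq_maxl.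
- by apply: embeds_trans Bm (pset_le _ _); rewrite leq_maxr.
Qed.

(** * Free sequences for set mappings *)

Definition seq_closed (A : Type) : Prop := embeds (seq A) A.

Lemma seq_closed_prod A : seq_closed A -> embeds (A * A) A.
Proof.
apply: embeds_trans; exists (fun p => [:: p.1; p.2]) => -[a b] [c d] /=.
by case=> -> ->.
Qed.

(** A sequence of subsets is coded by the set of codes of pairs of a position and a member of the
    entry there. The codes of one-term sequences mark the positions, since an empty entry leaves no
    other trace of the length. *)
Lemma seq_closed_set A : seq_closed A -> seq_closed (set A).
Proof.
move=> [f fi]; have [z0 _] : exists z : A, True by exists (f [::]).
have ni n m : f (nseq n z0) = f (nseq m z0) -> n = m.
  by move=> /fi /(congr1 size); rewrite !size_nseq.
pose e s := [set y : A | exists k (x : A) (B : set A),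
   [/\ onth s k = Some B, B x & y = f [:: f (nseq k z0); x]]] `|`
  [set y : A | exists2 k, (k < size s)%N & y = f [:: f (nseq k z0)]].
exists e => s t.
have sub s' t' : e s' `<=` e t' -> (size s' <= size t')%N /\
    forall k B D, onth s' k = Some B -> onth t' k = Some D -> B `<=` D.
  move=> h; split.
    rewrite leqNgt; apply/negP => lt.
    have [|[k [x [B [_ _ /fi //]]]]|[k kt /fi [/ni ek]]] := h (f [:: f (nseq (size t') z0)]).
      by right; exists (size t').
    by rewrite -ek ltnn in kt.
  move=> k B D sB tD x xB.
  have [|[k' [x' [B' [tB' B'x' /fi [/ni ek ex]]]]]|[k' kt /fi //]] := h (f [:: f (nseq k z0); x]).
    by left; exists k, x, B.
  by subst k' x'; move: tB'; rewrite tD => -[->].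
move=> /seteqP[/sub[st hst] /sub[ts hts]].
have sz : size s = size t by apply/eqP; rewrite eqn_leq st ts.
apply: (@eq_from_nth _ set0) => // i ilt.
have os r j : (j < size r)%N -> onth r j = Some (nth set0 r j).
  by elim: r j => [|? r IHr] [|j] //=; apply: IHr.
apply/seteqP; split; [apply: (hst i)|apply: (hts i)]; rewrite os -?sz //.
Qed.

(** A variant of the Kuratowski free set theorem. *)
Lemma free_seq A n W (j : pset n A -> W) (f : seq W -> set W) :
  seq_closed A -> injective j -> (forall s, embeds (set_type (f s)) A) ->
  exists xs : seq W, size xs = n /\
    forall s1 x s2, xs = s1 ++ x :: s2 -> ~ f (s1 ++ s2) x.
Proof.
move=> Acl ji fA; suff [xs [sxs _ xsP]] : exists xs : seq W, [/\ size xs = n,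
    forall x, List.In x xs -> range j x & forall s1 x s2, xs = s1 ++ x :: s2 -> ~ f (s1 ++ s2) x].
  by exists xs.
elim: n j f ji fA => [|n IHn] j f ji fA.
  by exists [::]; split=> // -[].
have cl m : seq_closed (pset m A) by elim: m => //= m; apply: seq_closed_set.
(* The singletons form a copy of [pset n A] among the indices, from which the later elements are
   taken. *)
pose j' (x : pset n A) := j [set x].
have j'i : injective j' by move=> x y /ji /seteqP[/(_ x) + _]; apply.
(* The values of [f] on sequences from the copy cover at most [pset n A] points, so by Cantor's
   theorem they miss a point of the range of [j]. *)
have [x [xj xf]] : exists x, range j x /\ forall s, ~ f (map j' s) x.
  apply: contrapT => nx; apply: (@cantor (pset n A)).
  have /choice[g gP] : forall z, exists s, f (map j' s) (j z).
    move=> z; apply: contrapT => nz; apply: nx; exists (j z); split; first by exists z.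
    by move=> s fs; apply: nz; exists s.
  apply: embeds_trans (seq_closed_prod (cl n)).
  have [e ei] := cl n; have [o oi] := pset_le A (leq0n n).
  pose h s := projT1 (cid (fA s)).
  have hi s : injective (h s) by rewrite /h; case: cid.
  exists (fun z => (e (g z), o (h (map j' (g z)) (exist _ (j z) (mem_set (gP z)))))) => z z'.
  move=> [/ei gz /oi].
  move: (gP z) (gP z'); rewrite -gz => a b /hi /(congr1 val) /=; exact: ji.
have [|xs [sxs xsj xsf]] := IHn j' (fun s => f (x :: s)) j'i.
  by move=> s; apply: fA.
exists (x :: xs); split; first by rewrite /= sxs.
  move=> y /= [<-//|/xsj[z _ <-]]; by exists [set z].
move=> [|y s1] z s2 /= [].
  move=> <- <-; have [t ->] : exists t, xs = map j' t; last exact: xf.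
  elim: xs xsj {sxs xsf} => [|y xs IHxs] xsj; first by exists [::].
  have [|t ->] := IHxs; first by move=> w wxs; apply: xsj; right.
  by have [|t0 _ <-] := xsj y; [left|exists (t0 :: t)].
by move=> <-; apply: xsf.
Qed.

(** * Formulas *)

Section Syntax.
Variable L : language.

Lemma eval_rename (M : structure L) V W (h : V -> W) (v : W -> M) (t : term L V) :
  eval v (term_rename h t) = eval (v \o h) t.
Proof. by elim: t => //= f args IH; congr finterp; apply/funext => i; apply: IH. Qed.

Lemma sat_rename (M : structure L) V W (h : V -> W) (v : W -> M) (phi : formula L V) :
  sat v (rename h phi) = sat (v \o h) phi.
Proof.
elim: phi W h v => {V} [V|V t u|V r args|V phi IH psi IH'|V phi IH] W h v //=.
- by rewrite !eval_rename.
- by congr rinterp; apply/funext => i; apply: eval_rename.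
- by rewrite IH IH'.
- apply/propext; split=> H m; have := H m; rewrite IH;
  by congr sat; apply/funext => -[].
Qed.

Lemma term_rename_comp V W U (h : V -> W) (k : W -> U) (t : term L V) :
  term_rename k (term_rename h t) = term_rename (k \o h) t.
Proof. by elim: t => //= f args IH; congr App; apply/funext => i; apply: IH. Qed.

Lemma rename_comp V W U (h : V -> W) (k : W -> U) (phi : formula L V) :
  rename k (rename h phi) = rename (k \o h) phi.
Proof.
elim: phi W U h k => {V} [V|V t u|V r args|V phi IH psi IH'|V phi IH] W U h k //=.
- by rewrite !term_rename_comp.
- by congr Rel; apply/funext => i; apply: term_rename_comp.
- by rewrite IH IH'.
- by rewrite IH; congr All; congr rename; apply/funext => -[].
Qed.

Lemma term_rename_id V (t : term L V) : term_rename id t = t.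
Proof. by elim: t => //= f args IH; congr App; apply/funext => i; apply: IH. Qed.

Lemma rename_id V (phi : formula L V) : rename id phi = phi.
Proof.
elim: phi => {V} [V|V t u|V r args|V phi IH psi IH'|V phi IH] //=.
- by rewrite !term_rename_id.
- by congr Rel; apply/funext => i; apply: term_rename_id.
- by rewrite IH IH'.
- by rewrite -[in RHS]IH; congr All; congr rename; apply/funext => -[].
Qed.

Lemma in_flat_map (I : finType) V (s : I -> seq V) :
  exists t : seq V, forall i x, List.In x (s i) -> List.In x t.
Proof.
exists (List.flat_map s (enum I)) => i x xi; apply/List.in_flat_map; exists i; split=> //.
have := mem_enum I i; elim: (enum I) => //= j l IH; rewrite inE.
by case/predU1P => [->|/IH]; [left|right].
Qed.

Lemma term_support V (t : term L V) : exists s : seq V, forall W (h k : V -> W),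
  (forall x, List.In x s -> h x = k x) -> term_rename h t = term_rename k t.
Proof.
elim: t => [x|f args IH].
  by exists [:: x] => W h k /= -> //; left.
have [s sP] := choice IH; have [t tP] := in_flat_map s.
exists t => W h k hk /=; congr App; apply/funext => i; apply: sP => x xi.
by apply: hk; apply: tP xi.
Qed.

Lemma formula_support V (phi : formula L V) : exists s : seq V, forall W (h k : V -> W),
  (forall x, List.In x s -> h x = k x) -> rename h phi = rename k phi.
Proof.
elim: phi => {V} [V|V t u|V r args|V phi [s sP] psi [t tP]|V phi [s sP]].
- by exists [::].
- have [s sP] := term_support t; have [s' sP'] := term_support u.
  exists (s ++ s') => W h k hk /=.
  by rewrite (sP _ _ k) ?(sP' _ _ k) // => x xs; apply: hk; apply/List.in_app_iff; auto.
- have [s sP] := choice (fun i => term_support (args i)).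
  have [t tP] := in_flat_map s.
  exists t => W h k hk /=; congr Rel; apply/funext => i; apply: sP => x xi.
  by apply: hk; apply: tP xi.
- exists (s ++ t) => W h k hk /=.
  by rewrite (sP _ _ k) ?(tP _ _ k) // => x xs; apply: hk; apply/List.in_app_iff; auto.
- exists (List.flat_map (fun o => if o is Some x then [:: x] else [::]) s) => W h k hk /=.
  rewrite (sP _ _ (omap k)) // => -[x|] // xs /=; rewrite hk //.
  by apply/List.in_flat_map; exists (Some x); split=> //; left.
Qed.

Lemma sat_support V (phi : formula L V) : exists s : seq V, forall (M : structure L) (u v : V -> M),
  (forall x, List.In x s -> u x = v x) -> sat u phi = sat v phi.
Proof.
have [s sP] := formula_support phi; exists s => M u v /sP uv.
by rewrite -[u]/(id \o u) -[v]/(id \o v) -!sat_rename uv.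
Qed.

(** Renaming by [g] and then by [v] fixes every formula supported by [s], so it can be written with
    finitely many numbered variables; off [s] the values of [g] are arbitrary. *)
Lemma finite_retract V (s : seq V) : exists n (g : V -> 'I_n) (v : 'I_n -> V),
  forall x, List.In x s -> v (g x) = x.
Proof.
have [[x0 _]|nV] := pselect (exists x : V, True); last first.
  have F (x : V) : False by apply: nV; exists x.
  have f0 : 'I_0 -> V by case.
  by exists 0, (fun x => False_rect _ (F x)), f0 => x; case: (F x).
pose t := x0 :: s.
have /choice[g gP] : forall x, exists i : 'I_(size t), List.In x s -> nth x0 t i = x.
  move=> x; have [xs|] := pselect (List.In x s); last by exists (@Ordinal (size t) 0 isT).
  have [i it ix] : exists2 i, (i < size s)%N & nth x0 s i = x.
    elim: s xs {t} => //= y s IH [<-|/IH[i si <-]]; first by exists 0.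
    by exists i.+1.
  by exists (@Ordinal (size t) i.+1 it).
by exists (size t), g, (fun i => nth x0 t i).
Qed.

Lemma formula_finite V (phi : formula L V) :
  exists n (v : 'I_n -> V) (psi : formula L 'I_n), phi = rename v psi.
Proof.
have [s sP] := formula_support phi; have [n [g [v vg]]] := finite_retract s.
exists n, v, (rename g phi); rewrite rename_comp -[LHS]rename_id.
by apply: sP => x /vg /= ->.
Qed.

Definition big_and V (l : seq (formula L V)) : formula L V :=
  foldr (fun phi psi => Neg (Imp phi (Neg psi))) (Neg Bot) l.

Lemma sat_big_and (M : structure L) V (v : V -> M) l :
  sat v (big_and l) <-> forall phi, List.In phi l -> sat v phi.
Proof.
elim: l => [|phi l IH] /=; first by split.
split=> [h psi [<-|pl]|h].
- by apply: contrapT => nphi; apply: h.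
- by apply/IH: psi pl; apply: contrapT => nl; apply: h => _.
- by apply; [apply: h; left|apply/IH => psi pl; apply: h; right].
Qed.

Lemma project_ord m V (phi : formula L ('I_m + V)) :
  exists psi : formula L V, forall (M : structure L) (v : V -> M),
    sat v psi <-> exists q : 'I_m -> M, sat (copair q v) phi.
Proof.
elim: m V phi => [|m IH] V phi.
  have e : 'I_0 -> V by case.
  exists (rename (copair e id) phi) => M v; rewrite sat_rename.
  have E q : v \o copair e id = copair q v by apply/funext => -[[]|].
  split=> [|[q]]; last by rewrite (E q).
  have q : 'I_0 -> M by case.
  by move=> h; exists q; rewrite -(E q).
(* The variable 0 of the block becomes the bound variable [None]; the others are quantified before
   it, by the inductive hypothesis. *)
pose r (s : 'I_m.+1 + V) : 'I_m + option V :=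
  match s with inl i => if unlift ord0 i is Some j then inl j else inr None
  | inr x => inr (Some x) end.
have [psi psiP] := IH _ (rename r phi).
exists (Neg (All (Neg psi))) => M v /=.
have E (q : 'I_m -> M) x : copair q (fun o => if o is Some y then v y else x) \o r =
    copair (fun i => if unlift ord0 i is Some j then q j else x) v.
  by apply/funext => -[i|y] //=; case: (unlift ord0 i).
split=> [h|[q qP] h].
  apply: contrapT => nq; apply: h => x /psiP[q]; rewrite sat_rename E => qP.
  by apply: nq; eexists; exact: qP.
apply: (h (q ord0)); apply/psiP; exists (fun j => q (lift ord0 j)).
rewrite sat_rename E; move: qP; congr sat; congr copair; apply/funext => i.
by case: unliftP => [j ->|->].
Qed.

(** Only finitely many of the quantified variables occur in the formula. *)
Lemma project V W (phi : formula L (V + W)) :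
  exists psi : formula L W, forall (M : structure L) (w : W -> M),
    sat w psi <-> exists v : V -> M, sat (copair v w) phi.
Proof.
have [s sP] := sat_support phi.
have [n [g [v vg]]] := finite_retract
  (List.flat_map (fun o : V + W => if o is inl x then [:: x] else [::]) s).
have [psi psiP] := project_ord
  (rename (fun o => match o with inl x => inl (g x) | inr y => inr y end) phi).
exists psi => M w; rewrite psiP; split=> -[q].
  rewrite sat_rename => qP; exists (q \o g); move: qP; congr sat.
  by apply/funext => -[].
move=> qP; exists (q \o v); rewrite sat_rename; move: qP.
rewrite (sP M _ ((copair (q \o v) w) \o
  (fun o => match o with inl x => inl (g x) | inr y => inr y end))) //.
move=> [x|y] // xs /=; congr q; rewrite vg //.
by apply/List.in_flat_map; exists (inl x); split=> //; left.
Qed.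

Fixpoint closure n : formula L 'I_n -> sentence L :=
  match n with
  | 0 => rename (fun i : 'I_0 => False_rect void (notF (ltn_ord i)))
  | m.+1 => fun phi => closure (All (rename (unlift ord0) phi))
  end.

Lemma rename_inj V W (h : V -> W) (k : W -> V) : cancel h k -> injective (@rename L V W h).
Proof.
move=> hk phi psi /(congr1 (rename k)); rewrite !rename_comp.
by have -> : k \o h = id; [apply/funext => x; apply: hk|rewrite !rename_id].
Qed.

Lemma closure_inj n : injective (@closure n).
Proof.
elim: n => [|n IH] phi psi /=.
  have e : void -> 'I_0 by case.
  by apply: (rename_inj (k := e)) => -[].
move=> /IH [].
apply: (rename_inj (k := fun o => if o is Some j then lift ord0 j else ord0)) => i.
by case: unliftP.
Qed.

(** The size of the language is bounded only through its sentences. A formula is therefore coded by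
    the closure of a finite presentation and the list of variables substituted in it; the length of
    the list gives back [n]. *)
Lemma embeds_formula V : embeds (formula L V) (sentence L * seq V).
Proof.
have /choice[f fP] : forall phi : formula L V, exists t : {n & (formula L 'I_n * ('I_n -> V))%type},
  phi = rename (projT2 t).2 (projT2 t).1.
  move=> phi; have [n [v [psi ->]]] := formula_finite phi.
  by exists (existT (fun n => (formula L 'I_n * ('I_n -> V))%type) n (psi, v)).
exists (fun phi => (closure (projT2 (f phi)).1, map (projT2 (f phi)).2 (enum 'I_(projT1 (f phi))))).
move=> phi psi e; rewrite (fP phi) (fP psi); move: e.
case: (f phi) (f psi) => n [a v] [m [b w]] /= [cl vw].
have nm : n = m by move: (congr1 size vw); rewrite !size_map -!enumT !size_enum_ord.
subst m; rewrite (closure_inj cl); congr rename; apply/funext => i.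
have vE (u : 'I_n -> V) : u i = nth (u i) (map u (enum 'I_n)) i.
  by rewrite (nth_map i) ?size_enum_ord // nth_ord_enum.
rewrite (vE v) vw (nth_map i) ?size_enum_ord // nth_ord_enum //.
Qed.

Lemma embeds_nat_sentence : embeds nat (sentence L).
Proof.
exists (fun n => iter n (fun phi => Neg phi) Bot).
by elim=> [|n IH] [|m] //= [/IH ->].
Qed.

End Syntax.

(** * Saturation and homogeneity *)

Lemma In_mem (T : eqType) (x : T) (s : seq T) : List.In x s <-> x \in s.
Proof.
elim: s => //= y s IH; rewrite inE; split=> [[->|/IH ->]|/predU1P[->|/IH]]; auto.
- by rewrite eqxx.
- by rewrite orbT.
Qed.

Lemma finite_set_list T (S : set T) : finite_set S <-> exists l, forall x, S x <-> List.In x l.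
Proof.
split=> [/(@finite_seqP {classic T})[s ->]|[l lS]].
  by exists s => x; split=> /(@In_mem {classic T}).
apply/(@finite_seqP {classic T}); exists l; apply/seteqP; split=> x.
  by move=> /lS/(@In_mem {classic T}).
by move=> /(@In_mem {classic T})/lS.
Qed.

Section Automorphisms.
Variables (L : language) (M : structure L).

Lemma eval_automorphism (sigma : M -> M) V (v : V -> M) (t : term L V) :
  automorphism sigma -> eval (sigma \o v) t = sigma (eval v t).
Proof.
move=> [_ fE _]; elim: t => //= f args IH; rewrite fE; congr finterp.
by apply/funext => i; apply: IH.
Qed.

Lemma sat_automorphism (sigma : M -> M) V (v : V -> M) (phi : formula L V) :
  automorphism sigma -> sat (sigma \o v) phi = sat v phi.
Proof.
move=> aut; have [bij fE rE] := aut; have [tau st ts] := bij.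
elim: phi v => {V} [V|V t u|V r args|V phi IH psi IH'|V phi IH] v //=.
- rewrite !eval_automorphism //; apply/propext; by split=> [/(can_inj st)|->].
- rewrite -(propext (rE r (fun i => eval v (args i)))); congr rinterp; apply/funext => i.
  by rewrite eval_automorphism.
- by rewrite IH IH'.
- apply/propext; split=> H m.
    rewrite -IH; have := H (sigma m); congr sat; by apply/funext => -[].
  have := H (tau m); rewrite -IH; congr sat; by apply/funext => -[x|] //=.
Qed.

Lemma automorphism_id : automorphism (@id M).
Proof. by split=> //; exists id. Qed.

Lemma automorphism_comp (sigma tau : M -> M) :
  automorphism sigma -> automorphism tau -> automorphism (sigma \o tau).
Proof.
move=> [b f r] [b' f' r']; split; first exact: bij_comp.
  by move=> g args /=; rewrite f' f.
by move=> g args; rewrite -(r' _ args) -(r _ (tau \o args)).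
Qed.

Lemma automorphism_inv (sigma : M -> M) : automorphism sigma ->
  exists tau, [/\ automorphism tau, cancel sigma tau & cancel tau sigma].
Proof.
move=> [[tau st ts] f r]; exists tau; split=> //.
have E n (args : 'I_n -> M) : sigma \o (tau \o args) = args by apply/funext => i /=.
split; first by exists sigma.
  by move=> g args; apply: (can_inj st); rewrite ts f E.
by move=> g args; rewrite -(r _ (tau \o args)) E.
Qed.

End Automorphisms.

Section Realize.
Variables (K : Type) (L : language) (M : structure L) (D : Type) (par : D -> M) (V : Type).
Hypotheses (M_sat : saturated K M) (K_sl : strong_limit K)
  (D_small : small K D) (V_small : small K V).

(** [saturated] concerns types in one variable. Types in the variables [V] are realized by Zorn's
    lemma on partial assignments [G] such that every finite part of [Gamma] has a solution extending
    [G]. *)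
Let partial_solution (Gamma : set (formula L (V + D))) (G : set (V * M)) : Prop :=
  forall l, (forall phi, List.In phi l -> Gamma phi) -> exists a : V -> M,
    (forall x m, G (x, m) -> a x = m) /\ forall phi, List.In phi l -> sat (copair a par) phi.

Let partial_functional Gamma G x m m' :
  partial_solution Gamma G -> G (x, m) -> G (x, m') -> m = m'.
Proof.
move=> /(_ [::]) [//|a [aG _]] /aG <- /aG <- //.
Qed.

(** A finite part of [Gamma] mentions finitely many variables, and the values that the union gives
    them already occur in one member of the chain. *)
Let chain_solution Gamma (F : set (set (V * M))) :
  partial_solution Gamma set0 ->
  (forall G, F G -> partial_solution Gamma G) -> total_on F subset ->
  partial_solution Gamma (\bigcup_(G in F) G).
Proof.
move=> G0 FP Ftot l lG.
have [s sP] : exists s : seq V, forall phi, List.In phi l -> forall u v : V -> M,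
    (forall x, List.In x s -> u x = v x) -> sat (copair u par) phi = sat (copair v par) phi.
  elim: l {lG} => [|phi l [s sP]]; first by exists [::].
  have [t tP] := sat_support phi.
  exists (List.flat_map (fun o : V + D => if o is inl x then [:: x] else [::]) t ++ s).
  move=> psi /= [<-|/sP h] u v uv; last first.
    by apply: h => x xs; apply: uv; apply/List.in_app_iff; right.
  apply: tP => -[x|//] xt /=; apply: uv; apply/List.in_app_iff; left.
  by apply/List.in_flat_map; exists (inl x); split=> //; left.
have [H HP Hs] : exists2 H, partial_solution Gamma H & (H `<=` \bigcup_(G in F) G) /\
    forall x m, List.In x s -> (\bigcup_(G in F) G) (x, m) -> H (x, m).
  suff [H [HF Hs]] : exists H, (H = set0 \/ F H) /\
      forall x m, List.In x s -> (\bigcup_(G in F) G) (x, m) -> H (x, m).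
    exists H; first by case: HF => [->|/FP].
    by split=> //; case: HF => [-> //|HF] y Hy; exists H.
  have ftn G G' x m m' : F G -> F G' -> G (x, m) -> G' (x, m') -> m = m'.
    move=> FG FG' Gx Gx'; have [/(_ _ Gx) h|/(_ _ Gx') h] := Ftot _ _ FG FG'.
      exact: partial_functional (FP _ FG') h Gx'.
    exact: partial_functional (FP _ FG) Gx h.
  elim: s {sP} => [|x s [H [HF Hs]]]; first by exists set0; split=> //; left.
  have [[m [G FG Gx]]|nx] := pselect (exists m, (\bigcup_(G in F) G) (x, m)); last first.
    exists H; split=> // y m /= [<-|ys] h; last exact: Hs.
    by exfalso; apply: nx; exists m.
  case: HF => [H0|HF].
    exists G; split; first by right.
    move=> y m' /= [<-|ys] [G' FG' Gy']; first by rewrite -(ftn _ _ _ _ _ FG FG' Gx Gy').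
    by have := Hs y m' ys; rewrite H0 => /(_ _) []; exists G'.
  have [HG|GH] := Ftot _ _ HF FG.
    exists G; split; first by right.
    move=> y m' /= [<-|ys] h; last by apply: HG; apply: Hs.
    by case: h => G' FG' Gy'; rewrite -(ftn _ _ _ _ _ FG FG' Gx Gy').
  exists H; split; first by right.
  move=> y m' /= [<-|ys] h; last exact: Hs.
  by apply: GH; case: h => G' FG' Gy'; rewrite -(ftn _ _ _ _ _ FG FG' Gx Gy').
have [a [aH al]] := HP l lG.
have /choice[b bP] : forall x, exists m, ((\bigcup_(G in F) G) (x, m)) \/
    (~ (exists m, (\bigcup_(G in F) G) (x, m))) /\ m = a x.
  move=> x; have [[m h]|h] := pselect (exists m, (\bigcup_(G in F) G) (x, m)).
    by exists m; left.
  by exists (a x); right.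
exists b; split.
  move=> x m h; case: (bP x) => [h'|[nx _]]; last by case: nx; exists m.
  case: h h' => G FG Gx [G' FG' Gx'].
  have [/(_ _ Gx) h|/(_ _ Gx') h] := Ftot _ _ FG FG'.
    exact: partial_functional (FP _ FG') Gx' h.
  exact: partial_functional (FP _ FG) h Gx.
move=> phi pl; rewrite (sP _ pl b a); first exact: al.
by move=> x xs; case: (bP x) => [/(Hs.2 _ _ xs)/aH -> //|[_ ->]].
Qed.

(** The value of [x0] is given by saturation: it realizes all formulas saying that a finite part of
    [Gamma] is solvable, with the assigned variables replaced by their values and the others
    quantified. *)
Let extend_solution Gamma (G : set (V * M)) x0 :
  partial_solution Gamma G -> (forall m, ~ G (x0, m)) ->
  exists m, partial_solution Gamma (G `|` [set (x0, m)]).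
Proof.
move=> GP nx0.
pose B := [set m | (exists c, par c = m) \/ exists x, G (x, m)].
have Bpar c : B (par c) by left; exists c.
have BG x m : G (x, m) -> B m by move=> h; right; exists x.
have B_small : card_lt B [set: K].
  apply/card_ltE.
  have DV := ideal_sum (@small_le K) (@small_set K K_sl) (@small_dir K) D_small V_small.
  apply: small_le DV.
  have /choice[h hP] : forall b : B, exists s : D + V,
      match s with inl c => par c = val b | inr x => G (x, val b) end.
    move=> [b bB]; case: (set_mem bB) => [[c cb]|[x xb]]; first by exists (inl c).
    by exists (inr x).
  exists h => a b ab; apply: val_inj; have := hP a; rewrite ab; have := hP b.
  case: (h b) => [c <- //|x hb ha]; exact: partial_functional GP ha hb.
have /choice[g gP] : forall x, exists s : V + (unit + set_type B), 
    [\/ x = x0 /\ s = inr (inl tt),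
        [/\ x <> x0, forall m, ~ G (x, m) & s = inl x] |
        exists m (h : G (x, m)), x <> x0 /\ s = inr (inr (exist _ m (mem_set (BG x m h))))].
  move=> x; have [->|xx0] := pselect (x = x0); first by exists (inr (inl tt)); constructor.
  have [[m h]|n] := pselect (exists m, G (x, m)).
    by exists (inr (inr (exist _ m (mem_set (BG x m h))))); constructor 3; exists m, h.
  by exists (inl x); constructor 2; split=> // m h; apply: n; exists m.
pose w (s : V + D) := match s with inl x => g x
  | inr c => inr (inr (exist _ (par c) (mem_set (Bpar c)))) end.
have wE (a : V -> M) : (forall x m, G (x, m) -> a x = m) ->
    copair a (copair (fun=> a x0) set_val) \o w = copair a par.
  move=> aG; apply/funext => -[x|c] //=.
  by case: (gP x) => [[-> ->]|[_ _ ->]|[m [h [_ ->]]]] //=; rewrite (aG _ _ h).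
pose Delta := [set psi : formula L (unit + set_type B) | exists2 l,
   (forall phi, List.In phi l -> Gamma phi) &
   forall v : unit + set_type B -> M, sat v psi <->
     exists q, sat (copair q v) (rename w (big_and l))].
have [|a aP] := M_sat B_small (Gamma := Delta).
  move=> S /finite_set_list[l lS] SD.
  have [l' [l'G l'P]] : exists l', (forall phi, List.In phi l' -> Gamma phi) /\
     forall a, (forall x m, G (x, m) -> a x = m) ->
       (forall phi, List.In phi l' -> sat (copair a par) phi) ->
       forall psi, List.In psi l -> sat (copair (fun=> a x0) set_val) psi.
    have : forall psi, List.In psi l -> Delta psi by move=> psi /lS/SD.
    elim: l {lS} => [|psi l IH] lD; first by exists [::].
    have [|l1 [l1G l1P]] := IH; first by move=> phi pl; apply: lD; right.
    have [|l2 l2G l2P] := lD psi; first by left.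
    exists (l2 ++ l1); split=> [phi /List.in_app_iff[/l2G|/l1G]//|a aG al phi /= [<-|pl]].
      apply/l2P; exists a; rewrite sat_rename wE //; apply/sat_big_and => chi cl.
      by apply: al; apply/List.in_app_iff; left.
    by apply: l1P pl => // chi cl; apply: al; apply/List.in_app_iff; right.
  have [a [aG al]] := GP _ l'G.
  by exists (fun=> a x0) => phi /lS pl; apply: l'P pl.
exists (a tt) => l lG.
have [psi psiP] := project (rename w (big_and l)).
have /aP/psiP[q] : Delta psi by exists l.
rewrite sat_rename; set u := _ \o w => uP.
have uE : u = copair (u \o inl) par by apply/funext => -[].
exists (u \o inl); split; last by rewrite -uE; apply/sat_big_and.
move=> x m /= [h|[-> ->]].
  rewrite /u /=; case: (gP x) => [[xE _]|[_ /(_ m)//]|[m' [h' [_ ->]]]] /=.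
    by move: h; rewrite xE => /nx0.
  exact: partial_functional GP h' h.
rewrite /u /=; case: (gP x0) => [[_ ->]|[//]|[m' [h' [//]]]] /=; by [].
Qed.

Lemma realize (Gamma : set (formula L (V + D))) :
  (forall l, (forall phi, List.In phi l -> Gamma phi) ->
     exists a : V -> M, forall phi, List.In phi l -> sat (copair a par) phi) ->
  exists a : V -> M, forall phi, Gamma phi -> sat (copair a par) phi.
Proof.
move=> fs; have G0 : partial_solution Gamma set0.
  by move=> l /fs[a aP]; exists a; split.
have [F FP Ftot|G [GP Gmax]] := @Zorn_bigcup _ [set G | partial_solution Gamma G].
  exact: chain_solution.
have /choice[u uP] : forall x, exists m, G (x, m).
  move=> x0; apply: contrapT => nx0.
  have [|m mP] := extend_solution (x0 := x0) GP; first by move=> m h; apply: nx0; exists m.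
  apply: Gmax mP; split; first by left.
  by move=> h; apply: nx0; exists m; apply: h; right.
exists u => phi Gphi; have [|a [aG al]] := GP [:: phi]; first by move=> _ [<-|//].
have -> : u = a by apply/funext => x; rewrite (aG _ _ (uP x)).
by apply: al; left.
Qed.

End Realize.

Lemma homogeneous_extend K L (M : structure L) D (par : D -> M) V (u u' : V -> M) :
  strongly_homogeneous K M -> strong_limit K -> small K D -> small K V ->
  (forall phi : formula L (V + D), sat (copair u par) phi -> sat (copair u' par) phi) ->
  exists sigma : M -> M, [/\ automorphism sigma, forall c, sigma (par c) = par c &
    forall x, sigma (u x) = u' x].
Proof.
move=> M_hom K_sl D_small V_small uu'.
have uu'E phi : sat (copair u par) phi <-> sat (copair u' par) phi.
  split; first exact: uu'.
  by move=> h; apply: contrapT => n; apply: (uu' (Neg phi)).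
pose B := range (copair u par).
have /choice[h hP] : forall b : B, exists s, copair u par s = val b.
  by move=> [b bB]; have [s _ sb] := set_mem bB; exists s.
pose f b := copair u' par (h b).
have fE s (sB : copair u par s \in B) : f (exist _ (copair u par s) sB) = copair u' par s.
  rewrite /f; set b : B := exist _ (copair u par s) sB; have := hP b; rewrite [val b]/=.
  (* Equations are preserved, so [f] does not depend on the chosen name of an element of [B]. *)
  have := (uu'E (Eq (Var L (h b)) (Var L s))); rewrite /= => -> //.
have [||sigma [aut sP]] := M_hom B f.
- apply/card_ltE.
  have VD := ideal_sum (@small_le K) (@small_set K K_sl) (@small_dir K) V_small D_small.
  by apply: small_le VD; exists h => a b ab; apply: val_inj; rewrite -!hP ab.
- move=> n phi v.
  have -> : set_val \o v = copair u par \o (h \o v) by apply/funext => i /=; rewrite hP.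
  have -> : f \o v = copair u' par \o (h \o v) by [].
  by rewrite -!sat_rename.
have sE s : sigma (copair u par s) = copair u' par s.
  have sB : copair u par s \in B by apply/mem_set; exists s.
  by rewrite -(fE _ sB) -sP.
exists sigma; split=> // [c|x]; first exact: (sE (inr c)).
exact: (sE (inl x)).
Qed.

Lemma embeds_void A : embeds void A.
Proof. by exists (fun x : void => match x with end) => -[]. Qed.

Section TheoryFacts.
Variables (L : language) (T : set (sentence L)).

(** That there are more than [size l] distinct elements is a sentence; it holds in an infinite
    model, hence in [M] by completeness. *)
Lemma complete_theory_infinite (M : structure L) : complete_theory T ->
  has_infinite_model T -> models M T -> forall l : seq M, exists x, ~ List.In x l.
Proof.
move=> [_ dec] [N [NT Ninf]] MT l; pose n := (size l).+1.
pose dist : formula L ('I_n + void) := big_and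
  (map (fun ij : 'I_n * 'I_n => Neg (Eq (Var L (inl ij.1)) (Var L (inl ij.2))))
     [seq ij <- enum {: 'I_n * 'I_n} | ij.1 != ij.2]).
have distP (S : structure L) q (v : void -> S) :
    sat (copair q v) dist <-> forall i j, i != j -> q i <> q j.
  rewrite /dist sat_big_and; split=> [h i j ij|h phi].
    have := h (Neg (Eq (Var L (inl i)) (Var L (inl j)))); rewrite /=; apply.
    apply/List.in_map_iff; exists (i, j); split=> //; apply/In_mem.
    by rewrite mem_filter /= ij mem_enum.
  move=> /List.in_map_iff[[i j] [<- /In_mem]]; rewrite mem_filter => /andP[/= ij _].
  exact: h.
have [psi psiP] := project dist.
have Mpsi : sat (fun x : void => match x with end : M) psi.
  have [/(_ M MT)//|/(_ N NT) /=] := dec psi.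
  have /infiniteP/card_leTE[f fi] := Ninf.
  case; apply/psiP; exists (fun i => f (val i)); apply/distP => i j.
  by apply: contra_neq_not => /fi /val_inj.
have /psiP[q /distP qi] := Mpsi.
apply: contrapT => nx.
have ql i : List.In (q i) l by apply: contrapT => h; apply: nx; exists (q i).
pose ML : eqType := {classic M}.
have : uniq (map (q : 'I_n -> ML) (enum 'I_n)).
  rewrite map_inj_uniq ?enum_uniq // => i j qij; apply: contrapT => nij.
  by apply: (qi i j) qij; apply/eqP.
move=> /(uniq_leq_size (s2 := (l : seq ML))); rewrite size_map size_enum_ord /n ltnn.
suff sub : {subset map (q : 'I_n -> ML) (enum 'I_n) <= (l : seq ML)} by move=> /(_ sub).
move=> _ /mapP[i _ ->]; apply/In_mem; apply: ql.
Qed.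

(** Otherwise, by saturation, [M] would realize the type of an element outside [M]. *)
Lemma saturated_card K (M : structure L) : saturated K M ->
  (forall l : seq M, exists x, ~ List.In x l) -> embeds K M.
Proof.
move=> sat_M inf; case: (embeds_total K M) => // MK; apply: contrapT => KM.
have Ms : card_lt [set: M] [set: K] by apply/card_ltTE.
pose Gamma := [set phi : formula L (unit + set_type [set: M]) |
  exists m, phi = Neg (Eq (Var L (inl tt)) (Var L (inr m)))].
have [|a aP] := sat_M _ Ms Gamma.
  move=> S /finite_set_list[l lS] SG.
  have [l' l'P] : exists l' : seq M, forall x, ~ List.In x l' ->
      forall phi, List.In phi l -> sat (copair (fun=> x) set_val) phi.
    have : forall phi, List.In phi l -> Gamma phi by move=> phi /lS/SG.
    elim: l {lS} => [|phi l IH] lG; first by exists [::].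
    have [|l' l'P] := IH; first by move=> psi pl; apply: lG; right.
    have [|m ->] := lG phi; first by left.
    exists (val m :: l') => x nx psi /= [<-|pl].
      by move=> /= xm; apply: nx; left.
    by apply: l'P => // h; apply: nx; right.
  have [x xl] := inf l'; exists (fun=> x) => phi /lS; exact: l'P.
have m1 : (a tt) \in [set: M] by apply/mem_set.
have /= := aP (Neg (Eq (Var L (inl tt)) (Var L (inr (exist _ (a tt) m1))))).
by apply=> //; exists (exist _ (a tt) m1).
Qed.

(** Compactness inside a saturated model: if every finite size were shattered, a type in the small
    set [W] of variables would describe an infinite shattered family, and realizing it would give
    the independence property. *)
Lemma NIP_bound K (M : structure L) V (theta : formula L (V + nat)) :
  NIP T -> models M T -> saturated K M -> strong_limit K -> small K nat ->
  small K V -> exists N, forall (c : nat -> nat -> M) (alpha : set nat -> V -> M),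
    ~ forall i I, (i < N)%N -> (sat (copair (alpha I) (c i)) theta <-> I i).
Proof.
move=> nip MT M_sat K_sl K_nat V_small; apply: contrapT => nN.
have {}nN N : exists (c : nat -> nat -> M) (alpha : set nat -> V -> M),
    forall i I, (i < N)%N -> (sat (copair (alpha I) (c i)) theta <-> I i).
  apply: contrapT => h; apply: nN; exists N => c alpha cP; apply: h.
  by exists c, alpha.
pose W := (nat * nat + set nat * V)%type.
pose rho i I (s : V + nat) : W + void := match s with inl v => inl (inr (I, v))
  | inr k => inl (inl (i, k)) end.
pose Gamma := [set phi : formula L (W + void) | exists i (I : set nat),
  (I i /\ phi = rename (rho i I) theta) \/ (~ I i /\ phi = Neg (rename (rho i I) theta))].
pose par (x : void) : M := match x with end.
have rhoE (u : W -> M) i I : copair u par \o rho i I =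
    copair (fun v => u (inr (I, v))) (fun k => u (inl (i, k))).
  by apply/funext => -[].
have W_small : small K W.
  apply: ideal_sum => //; [exact: small_le|exact: small_set|exact: small_dir|..].
    by apply: ideal_prod => //; [exact: small_le|exact: small_set|exact: small_dir].
  apply: ideal_prod => //; [exact: small_le|exact: small_set|exact: small_dir|].
  exact: small_set.
have [||a aP] := @realize K L M void par W M_sat K_sl _ W_small Gamma.
- exact: small_le (embeds_void nat) K_nat.
- move=> l lG.
  have [N NP] : exists N, forall phi, List.In phi l -> exists i (I : set nat), (i < N)%N /\
      ((I i /\ phi = rename (rho i I) theta) \/ (~ I i /\ phi = Neg (rename (rho i I) theta))).
    elim: l lG => [|phi l IH] lG; first by exists 0.
    have [|N NP] := IH; first by move=> psi pl; apply: lG; right.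
    have [|i [I iI]] := lG phi; first by left.
    exists (maxn i.+1 N) => psi /= [<-|/NP[j [J [jN jP]]]].
      by exists i, I; rewrite leq_max leqnn.
    by exists j, J; rewrite leq_max jN orbT.
  have [c [alpha cP]] := nN N.
  exists (fun w : W => match w with inl ik => c ik.1 ik.2 | inr Iv => alpha Iv.1 Iv.2 end).
  move=> phi /NP[i [I [iN [[Ii ->]|[nIi ->]]]]] /=; rewrite sat_rename rhoE.
    exact/cP.
  by move=> /(cP i I iN).
have [n [w [psi thetaE]]] := formula_finite theta.
(* In [has_IP] the sequence comes before the tuples indexed by sets, so the sides are exchanged.
   Each side gets all [n] variables; those which belong to the other side receive arbitrary
   values. *)
apply: (nip n n (rename (fun k => if w k is inl _ then inr k else inl k) psi)).
exists M; split=> //.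
exists (fun i k => a (inl (i, if w k is inr j then j else 0))).
exists (fun I k => if w k is inl v then a (inr (I, v)) else a (inl (0, 0))) => i I.
rewrite sat_rename.
have -> : sat (copair (fun k => a (inl (i, if w k is inr j then j else 0)))
    (fun k => if w k is inl v then a (inr (I, v)) else a (inl (0, 0))) \o
    (fun k => if w k is inl _ then inr k else inl k)) psi =
    sat (copair a par) (rename (rho i I) theta).
  rewrite sat_rename rhoE thetaE sat_rename; congr sat; apply/funext => k /=.
  by move E : (w k) => [v|j] /=; rewrite E.
split=> [h|Ii]; last by apply: aP; exists i, I; left.
apply: contrapT => nI; have : Gamma (Neg (rename (rho i I) theta)) by exists i, I; right.
by move=> /aP /=; apply.
Qed.

End TheoryFacts.

(** * Definable and type-definable sets *)

Section Definable.
Variables (L : language) (C C' : structure L) (iota : C -> C').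

Definition definable V (D : set (V -> C')) : Prop :=
  exists phi : formula L (V + C), forall u, D u <-> sat (copair u iota) phi.

Lemma definable_ext V (D E : set (V -> C')) : (forall u, D u <-> E u) -> definable D -> definable E.
Proof. by move=> DE [phi phiP]; exists phi => u; rewrite -DE. Qed.

Lemma definable_true V : definable [set u : V -> C' | True].
Proof. by exists (Neg Bot) => u; split=> _ /=. Qed.

Lemma definable_imp V (D E : set (V -> C')) : definable D -> definable E -> definable [set u | D u -> E u].
Proof.
by move=> [phi phiP] [psi psiP]; exists (Imp phi psi) => u /=; rewrite phiP psiP.
Qed.

Lemma definable_not V (D : set (V -> C')) : definable D -> definable [set u | ~ D u].
Proof. by move=> [phi phiP]; exists (Neg phi) => u /=; rewrite phiP. Qed.

Lemma definable_and V (D E : set (V -> C')) : definable D -> definable E -> definable [set u | D u /\ E u].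
Proof.
move=> dD /definable_not dE; apply: definable_ext (definable_not (definable_imp dD dE)) => u /=.
split=> [h|[Du Eu] h]; last exact: h.
by split; apply: contrapT => n; apply: h => Du // Eu; apply: n.
Qed.

Lemma definable_all_seq I V (F : I -> set (V -> C')) (l : seq I) :
  (forall i, List.In i l -> definable (F i)) -> definable [set u | forall i, List.In i l -> F i u].
Proof.
elim: l => [|i l IH] dF; first by apply: definable_ext (definable_true V) => u; split=> // _ i [].
have di : definable (F i) by apply: dF; left.
have dl : definable [set u | forall i, List.In i l -> F i u].
  by apply: IH => j jl; apply: dF; right.
apply: definable_ext (definable_and di dl) => u /=; split=> [[h1 h2] j [<-|]|h]; auto.
Qed.

Lemma definable_preim V W (r : V -> W) (D : set (V -> C')) :
  definable D -> definable [set u : W -> C' | D (u \o r)].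
Proof.
move=> [phi phiP]; exists (rename (fun s => match s with inl x => inl (r x) | inr c => inr c end) phi).
move=> u /=; rewrite phiP sat_rename; suff -> : copair (u \o r) iota =
  copair u iota \o (fun s => match s with inl x => inl (r x) | inr c => inr c end) by [].
by apply/funext => -[].
Qed.

Lemma definable_ex V W (D : set (V + W -> C')) :
  definable D -> definable [set w | exists v, D (copair v w)].
Proof.
move=> [phi phiP].
have [psi psiP] := project (rename (fun s : (V + W) + C => match s with
  | inl (inl x) => inl x | inl (inr y) => inr (inl y) | inr c => inr (inr c) end) phi).
exists psi => w /=; rewrite psiP.
suff E v : D (copair v w) <-> sat (copair v (copair w iota)) (rename
    (fun s : (V + W) + C => match s with
  | inl (inl x) => inl x | inl (inr y) => inr (inl y) | inr c => inr (inr c) end) phi).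
  by split=> -[v /E vP]; exists v.
rewrite phiP sat_rename; suff -> : copair (copair v w) iota = copair v (copair w iota) \o
  (fun s : (V + W) + C => match s with
  | inl (inl x) => inl x | inl (inr y) => inr (inl y) | inr c => inr (inr c) end) by [].
by apply/funext => -[[]|].
Qed.

Lemma definable_support V (D : set (V -> C')) : definable D -> exists s : seq V,
  forall u v, (forall x, List.In x s -> u x = v x) -> D u <-> D v.
Proof.
move=> [phi phiP]; have [s sP] := sat_support phi.
exists (List.flat_map (fun o : V + C => if o is inl x then [:: x] else [::]) s) => u v uv.
rewrite !phiP (sP C' _ (copair v iota)) // => -[x|//] xs /=; apply: uv.
by apply/List.in_flat_map; exists (inl x); split=> //; left.
Qed.

Lemma definable_aut V (D : set (V -> C')) sigma u : definable D -> automorphism_over iota sigma ->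
  D (sigma \o u) <-> D u.
Proof.
move=> [phi phiP] [aut fixC]; rewrite !phiP.
have -> : copair (sigma \o u) iota = sigma \o copair u iota.
  by apply/funext => -[x|c] //=; rewrite fixC.
by rewrite sat_automorphism.
Qed.

Definition tp_eq V (u v : V -> C') : Prop := forall D, definable D -> D u -> D v.

Lemma tp_eq_sym V (u v : V -> C') : tp_eq u v -> tp_eq v u.
Proof.
move=> uv D dD Dv; apply: contrapT => nDu; exact: (uv _ (definable_not dD)) nDu Dv.
Qed.

Lemma tp_eq_trans V (u v w : V -> C') : tp_eq u v -> tp_eq v w -> tp_eq u w.
Proof. by move=> uv vw D dD /(uv _ dD)/(vw _ dD). Qed.

Lemma tp_eq_preim V W (r : V -> W) (u v : W -> C') : tp_eq u v -> tp_eq (u \o r) (v \o r).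
Proof. by move=> uv D dD; apply: (uv [set w : W -> C' | D (w \o r)]); apply: definable_preim. Qed.

Lemma tp_eq_aut V sigma (u : V -> C') : automorphism_over iota sigma -> tp_eq u (sigma \o u).
Proof. by move=> aut D dD Du; apply/(definable_aut _ dD aut). Qed.

Lemma automorphism_over_comp sigma tau : automorphism_over iota sigma ->
  automorphism_over iota tau -> automorphism_over iota (sigma \o tau).
Proof.
move=> [a f] [b g]; split; first exact: automorphism_comp.
by move=> m /=; rewrite g f.
Qed.

Lemma automorphism_over_inv sigma : automorphism_over iota sigma ->
  exists tau, [/\ automorphism_over iota tau, cancel sigma tau & cancel tau sigma].
Proof.
move=> [a f]; have [tau [t st ts]] := automorphism_inv a.
by exists tau; split=> //; split=> // m; rewrite -{1}(f m) st.
Qed.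

(** [D] is an intersection of definable sets. *)
Definition type_definable V (D : set (V -> C')) : Prop :=
  forall u, (forall F, definable F -> D `<=` F -> F u) -> D u.

Lemma type_definable_defi V (D : set (V -> C')) : definable D -> type_definable D.
Proof. by move=> dD u; apply. Qed.

Lemma type_definable_all I V (D : I -> set (V -> C')) :
  (forall i, type_definable (D i)) -> type_definable [set u | forall i, D i u].
Proof.
move=> tD u h i; apply: tD => F dF DF; apply: h => // v /(_ i); exact: DF.
Qed.

Lemma type_definable_and V (D E : set (V -> C')) : type_definable D -> type_definable E -> type_definable [set u | D u /\ E u].
Proof.
move=> tD tE u h; split; [apply: tD|apply: tE] => F dF DF; apply: h => // v [Dv Ev];
exact: DF.
Qed.

Lemma type_definable_preim V W (r : V -> W) (D : set (V -> C')) :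
  type_definable D -> type_definable [set u : W -> C' | D (u \o r)].
Proof.
move=> tD u h; apply: tD => F dF DF.
by apply: (h [set w : W -> C' | F (w \o r)]); [apply: definable_preim|move=> w /DF].
Qed.

Lemma type_definable_aut V (D : set (V -> C')) sigma u : type_definable D -> automorphism_over iota sigma ->
  D (sigma \o u) <-> D u.
Proof.
move=> tD aut; split=> h; apply: tD => F dF DF; [rewrite -(definable_aut _ dF aut)|rewrite (definable_aut _ dF aut)];
exact: DF.
Qed.

Lemma type_definable_tp_eq V (D : set (V -> C')) u v : type_definable D -> tp_eq u v -> D u -> D v.
Proof. by move=> tD uv Du; apply: tD => F dF DF; apply: uv => //; apply: DF. Qed.

Lemma type_definable_tp V (u : V -> C') : type_definable [set v | tp_eq u v].
Proof. by move=> v h D dD Du; apply: h => // w; apply. Qed.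

End Definable.

Definition monster_over K L (C C' : structure L) (iota : C -> C') : Prop :=
  [/\ saturated K C', strongly_homogeneous K C', strong_limit K, small K nat & small K C].

Section Monster.
Variables (K : Type) (L : language) (C C' : structure L) (iota : C -> C').
Hypothesis mon : monster_over K iota.

Lemma tp_eq_conj V (u v : V -> C') : small K V -> tp_eq iota u v ->
  exists2 sigma, automorphism_over iota sigma & sigma \o u = v.
Proof.
have [_ hom sl _ sC] := mon; move=> sV uv.
have [phi uphi|sigma [aut fixC su]] := homogeneous_extend (par := iota) (u := u) (u' := v) hom sl sC sV.
  by apply: (uv [set u | sat (copair u iota) phi]) => //; exists phi.
by exists sigma => //; apply/funext.
Qed.

Lemma definable_compact I V (F : I -> set (V -> C')) : small K V ->
  (forall i, definable iota (F i)) -> (forall l : seq I, exists u, forall i, List.In i l -> F i u) ->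
  exists u, forall i, F i u.
Proof.
have [sat _ sl sn sC] := mon; move=> sV dF fip.
have /choice[f fP] := dF.
have [|u uP] := realize (par := iota) (Gamma := range f) sat sl sC sV.
  move=> l lf; have [l' l'P] : exists l', forall phi, List.In phi l -> exists2 i, List.In i l' & f i = phi.
    elim: l lf => [|phi l IH] lf; first by exists [::].
    have [|l' l'P] := IH; first by move=> psi pl; apply: lf; right.
    have [|i _ fi] := lf phi; first by left.
    exists (i :: l') => psi /= [<-|/l'P[j jl fj]]; first by exists i => //; left.
    by exists j => //; right.
  by have [u uP] := fip l'; exists u => phi /l'P[i il <-]; apply/fP; apply: uP.
by exists u => i; apply/fP; apply: uP; exists i.
Qed.

Lemma type_definable_compact I V (F : I -> set (V -> C')) : small K V ->
  (forall i, type_definable iota (F i)) -> (forall l : seq I, exists u, forall i, List.In i l -> F i u) ->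
  exists u, forall i, F i u.
Proof.
move=> sV tF fip; pose J := {D : set (V -> C') | definable iota D /\ exists i, F i `<=` D}.
have [|l|u uP] := @definable_compact J V (fun j => proj1_sig j) sV.
- by case=> D [].
- have [l' l'P] : exists l' : seq I, forall u, (forall i, List.In i l' -> F i u) ->
      forall j, List.In j l -> proj1_sig j u.
    elim: l => [|[D [dD [i FD]]] l [l' l'P]]; first by exists [::].
    exists (i :: l') => u h j /= [<-|jl] /=; first by apply: FD; apply: h; left.
    by apply: l'P jl => k kl; apply: h; right.
  by have [u uP] := fip l'; exists u; apply: l'P.
exists u => i; apply: tF => D dD FD.
have jP : definable iota D /\ exists i, F i `<=` D by split=> //; exists i.
exact: (uP (exist _ D jP)).
Qed.

Lemma type_definable_compact_sub I V (F : I -> set (V -> C')) (G : set (V -> C')) : small K V ->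
  (forall i, type_definable iota (F i)) -> definable iota G -> (forall u, (forall i, F i u) -> G u) ->
  exists l : seq I, forall u, (forall i, List.In i l -> F i u) -> G u.
Proof.
move=> sV tF dG FG; apply: contrapT => nl.
have [o|l|u uP] := @type_definable_compact (option I) V
   (fun o => if o is Some i then F i else [set u | ~ G u]) sV.
- by case: o => [i|]; [apply: tF|apply: type_definable_defi; apply: definable_not].
- apply: contrapT => nu; apply: nl.
  exists (List.flat_map (fun o => if o is Some i then [:: i] else [::]) l) => u uF.
  apply: contrapT => nG; apply: nu; exists u => -[i|//] il; apply: uF.
  by apply/List.in_flat_map; exists (Some i); split=> //; left.
by apply: (uP None); apply: FG => i; apply: (uP (Some i)).
Qed.

End Monster.

(** * Indiscernible sequences *)

Lemma nonprincipal_ultrafilter : exists U : set (set nat),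
  [/\ forall A B, A `<=` B -> U A -> U B, forall A B, U A -> U B -> U (A `&` B),
      ~ U set0, forall A, U A \/ U (~` A) & forall n, U [set i | (n <= i)%N]].
Proof.
have [U [UU sU]] := ultraFilterLemma (F := \oo) _.
exists U; split.
- exact: filterS.
- exact: filterI.
- exact: filter_not_empty.
- by move=> A; apply: in_ultra_setVsetC.
- by move=> n; apply: sU; exists n.
Qed.

Definition scons (i : nat) (s : nat -> nat) (k : nat) : nat := if k is m.+1 then s m else i.

Definition incr (h : nat -> nat) : Prop := forall k l, (k < l)%N -> (h k < h l)%N.

Definition depends_below (n : nat) (P : (nat -> nat) -> Prop) : Prop :=
  forall s t, (forall k, (k < n)%N -> s k = t k) -> P s <-> P t.

Section IteratedLimit.
Variable U : set (set nat).
Hypotheses (US : forall A B, A `<=` B -> U A -> U B)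
  (UI : forall A B, U A -> U B -> U (A `&` B)) (U0 : ~ U set0)
  (UC : forall A, U A \/ U (~` A)) (Uge : forall n, U [set i | (n <= i)%N]).

(** [P] holds for [U]-almost all [s 0], for [U]-almost all [s 1], and so on. *)
Fixpoint iter_lim (n : nat) (P : (nat -> nat) -> Prop) : Prop :=
  if n is m.+1 then U [set i | iter_lim m (fun s => P (scons i s))] else P (fun=> 0).

Lemma iter_lim_mono n (P Q : (nat -> nat) -> Prop) :
  (forall s, P s -> Q s) -> iter_lim n P -> iter_lim n Q.
Proof.
elim: n P Q => [|n IH] P Q PQ /=; first exact: PQ.
by apply: US => i; apply: IH => s; apply: PQ.
Qed.

Lemma iter_lim_and n P Q : iter_lim n P -> iter_lim n Q -> iter_lim n (fun s => P s /\ Q s).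
Proof.
elim: n P Q => [//|n IH] P Q /= hP hQ.
by apply: US (UI hP hQ) => i [/= ip iq]; apply: IH.
Qed.

Lemma iter_lim_const n Q : iter_lim n (fun=> Q) <-> Q.
Proof.
elim: n => [//|n IH] /=; split=> [h|q].
  apply: contrapT => nq; apply: U0; apply: US h => i /=.
  by move=> /IH.
by apply: US (Uge 0) => i _ /=; apply/IH.
Qed.

Lemma iter_lim_not n P : ~ iter_lim n P -> iter_lim n (fun s => ~ P s).
Proof.
elim: n P => [//|n IH] P /= h.
case: (UC [set i | iter_lim n (fun s => P (scons i s))]) => [//|].
by apply: US => i /= /IH.
Qed.

Lemma iter_lim_ex n P : iter_lim n P -> exists s, P s.
Proof.
move=> h; apply: contrapT => nP.
apply/(iter_lim_const n False)/(iter_lim_mono _ h) => s Ps.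
by apply: nP; exists s.
Qed.

(** [U] contains all final segments, so each coordinate may be required to exceed the previous one;
    the bound [b] on the first coordinate carries this through the induction. *)
Lemma iter_lim_incr n P : depends_below n P -> (forall s, incr s -> P s) -> iter_lim n P.
Proof.
move=> dP hP; have [b {}hP] : exists b, forall s, incr s -> (b <= s 0)%N -> P s by exists 0 => s /hP.
elim: n P b dP hP => [|n IH] P b dP hP /=.
  apply/(dP _ (fun k => b + k)) => //; apply: hP; last by rewrite /= addn0.
  by move=> k l; rewrite ltn_add2l.
apply: US (Uge b) => i /= bi; apply: (IH _ i.+1).
  by move=> s t st; apply: dP => -[|k] //= /st.
move=> s si is0; apply: hP => //= -[|k] [|l] //= kl; last exact: si.
by apply: leq_trans is0 _; case: l kl => // l _; apply: ltnW; apply: si.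
Qed.

(** A limit over a coordinate outside the range of [h] changes nothing, and [h] keeps the order of
    the other limits. This is the source of indiscernibility. *)
Lemma iter_lim_reindex m n P h : depends_below n P -> incr h ->
  (forall k, (k < n)%N -> (h k < m)%N) ->
  iter_lim m (fun s => P (s \o h)) <-> iter_lim n P.
Proof.
elim: m n P h => [|m IH] n P h dP hi hm.
  by case: n dP hm => [//|n] _ /(_ 0 isT).
case: n dP hm => [|n] dP hm.
  suff -> : (fun s => P (s \o h)) = (fun=> P (fun=> 0)) by apply: iter_lim_const.
  by apply/funext => s; apply/propext; apply: dP.
case h0 : (h 0) => [|k].
  rewrite /=; suff E i : iter_lim m (fun s => P (scons i s \o h)) <->
      iter_lim n (fun s => P (scons i s)).
    by split; apply: US => i /= /E.
  rewrite -(IH n (fun s => P (scons i s)) (fun k => (h k.+1).-1)).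
  - suff -> : (fun s => P (scons i s \o h)) =
      (fun s => P (scons i (s \o (fun k => (h k.+1).-1)))) by [].
    apply/funext => s; congr P; apply/funext => -[|k] /=; first by rewrite h0.
    by have := hi 0 k.+1 isT; case: (h k.+1).
  - by move=> s t st; apply: dP => -[|j] //= /st.
  - move=> j l jl; have := hi j.+1 l.+1 jl; have := hi 0 j.+1 isT.
    by case: (h j.+1) => // a _; case: (h l.+1).
  - move=> j jn; have := hm j.+1 jn; have := hi 0 j.+1 isT; by case: (h j.+1).
have hS j : h j = ((h j).-1).+1.
  by case: j => [|j]; [rewrite h0|have := hi 0 j.+1 isT; case: (h j.+1)].
have E : iter_lim m (fun s => P (s \o (fun j => (h j).-1))) <-> iter_lim n.+1 P.
  apply: IH => // [j l /hi|j jn]; first by rewrite (hS j) (hS l).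
  by have := hm j jn; rewrite (hS j).
rewrite -E -(iter_lim_const 1 (iter_lim m _)) /=.
suff -> : (fun i => iter_lim m (fun s => P (scons i s \o h))) =
  (fun=> iter_lim m (fun s => P (s \o (fun j => (h j).-1)))) by [].
apply/funext => i; congr iter_lim; apply/funext => s; congr P.
by apply/funext => j /=; rewrite (hS j).
Qed.

End IteratedLimit.

Definition env V M (u : nat -> V -> M) (kv : nat * V) : M := u kv.1 kv.2.

Section Indiscernibles.
Variables (K : Type) (L : language) (C C' : structure L) (iota : C -> C').
Hypothesis mon : monster_over K iota.

(** Indiscernibility over [C] of a sequence of tuples of elements; [indiscernible]
    concerns classes. *)
Definition indiscernible_seq V (u : nat -> V -> C') : Prop :=
  forall D h, definable iota D -> incr h -> D (env u) -> D (env (u \o h)).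

Lemma indiscernible_seq_tp_eq V (u : nat -> V -> C') h : indiscernible_seq u -> incr h -> tp_eq iota (env u) (env (u \o h)).
Proof. by move=> ru hi D dD; apply: ru. Qed.

(** Passage to a sequence of blocks: each reindexing of the blocks must be induced by an increasing
    reindexing of the terms. *)
Lemma indiscernible_seq_reindex V W (u : nat -> V -> C') (r : nat * W -> nat * V) : indiscernible_seq u ->
  (forall h, incr h -> exists2 h', incr h' &
     forall m w, r (h m, w) = (h' (r (m, w)).1, (r (m, w)).2)) ->
  indiscernible_seq (fun m w => env u (r (m, w))).
Proof.
move=> ru rP D h dD hi Du; have [h' hi' rE] := rP h hi.
have := ru [set w : nat * V -> C' | D (w \o r)] h' (definable_preim r dD) hi' => /(_ _) /=.
have -> : env u \o r = env (fun m w => env u (r (m, w))) by apply/funext => -[].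
move=> /(_ Du); congr D; apply/funext => -[m w] /=.
by rewrite /env /= rE.
Qed.

Lemma indiscernible_seq_pair V (u : nat -> V -> C') i j k l : indiscernible_seq u -> (i < j)%N -> (k < l)%N ->
  tp_eq iota (copair (u i) (u j)) (copair (u k) (u l)).
Proof.
move=> ru; have E a b : (a < b)%N ->
    tp_eq iota (copair (u 0) (u 1)) (copair (u a) (u b)).
  move=> ab; have hi : incr (fun k => if k is m.+1 then b + m else a).
    by move=> [|x] [|y] //= xy; lia.
  move=> D dD Du.
  pose r (s : V + V) : nat * V := match s with inl x => (0, x) | inr x => (1, x) end.
  have := ru _ _ (definable_preim r dD) hi; rewrite /=.
  have -> : env u \o r = copair (u 0) (u 1) by apply/funext => -[].
  move=> /(_ Du); congr D; apply/funext => -[x|x] //=.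
  by rewrite /env /= addn0.
by move=> /E ij /E kl; apply: tp_eq_trans (tp_eq_sym ij) kl.
Qed.

(** Iterated limits along an ultrafilter play the role of Ramsey's theorem: the definable sets that
    hold in the limit form a complete finitely satisfiable type over C, and its realization is
    indiscernible. *)
Lemma extract_indiscernible V (u : nat -> V -> C') : small K V ->
  exists2 u', indiscernible_seq u' & forall D, definable iota D ->
    (forall s, incr s -> D (env (u \o s))) -> D (env u').
Proof.
move=> sV; have [U [US UI U0 UC Uge]] := nonprincipal_ultrafilter.
have dep D : definable iota D -> exists n, depends_below n (fun s => D (env (u \o s))).
  move=> /definable_support[s sP].
  have [n nP] : exists n, forall kv, List.In kv s -> (kv.1 < n)%N.
    elim: s {sP} => [|kv s [n IH]]; first by exists 0.
    exists (maxn kv.1.+1 n) => kv' /= [<-|/IH h]; first by rewrite leq_max leqnn.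
    by rewrite leq_max h orbT.
  exists n => s1 s2 s12; apply: sP => kv /nP kn; by rewrite /env /= s12.
pose lim (D : set (nat * V -> C')) := exists n, depends_below n (fun s => D (env (u \o s))) /\
  iter_lim U n (fun s => D (env (u \o s))).
(* The number of limits may be raised, so that finitely many sets are compared at a common one. *)
have lim_ge D : lim D -> exists n, forall m, (n <= m)%N -> iter_lim U m (fun s => D (env (u \o s))).
  move=> [n [dn nP]]; exists n => m nm.
  have nm' k : (k < n)%N -> (k < m)%N by move=> kn; apply: leq_trans kn nm.
  have [_] := iter_lim_reindex US U0 Uge (m := m) (h := id) dn (fun k l => id) nm'.
  by apply.
pose J := {D : set (nat * V -> C') | definable iota D /\ lim D}.
have snV : small K (nat * V)%type.
  have [_ _ sl sn _] := mon.
  by apply: ideal_prod => //; [exact: small_le|exact: small_set|exact: small_dir].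
have [|l|w wP] := definable_compact mon (F := fun j : J => proj1_sig j) snV.
- by case=> D [].
- have [n nP] : exists n, forall m, (n <= m)%N ->
      iter_lim U m (fun s => forall j : J, List.In j l -> proj1_sig j (env (u \o s))).
    elim: l => [|[D [dD limD]] l [n nP]].
      by exists 0 => m _; apply: iter_lim_mono (_ : iter_lim U m (fun=> True)) => //;
        apply/(iter_lim_const US U0 Uge).
    have [n' n'P] := lim_ge D limD; exists (maxn n n') => m; rewrite geq_max => /andP[nm n'm].
    have := iter_lim_and US UI (n'P m n'm) (nP m nm).
    by apply: iter_lim_mono => // s [h1 h2] j /= [<-|/h2].
  have [s sP] := iter_lim_ex US U0 Uge (nP n (leqnn n)).
  by exists (env (u \o s)).
pose u' k v := w (k, v).
have u'E : env u' = w by apply/funext => -[].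
have limP D : definable iota D -> lim D -> D (env u').
  by move=> dD lD; rewrite u'E; have /= := wP (exist _ D (conj dD lD)).
exists u'.
  move=> D h dD hi Du'.
  have [n nP] := dep D dD.
  have [lD|nlD] := pselect (lim D); last first.
    exfalso; apply: (limP (fun w => ~ D w)) => //; first exact: definable_not.
    exists n; split; first by move=> s t /nP st; split=> a b; apply: a; apply/st.
    by apply: iter_lim_not => // lD; apply: nlD; exists n.
  have := limP _ (definable_preim (fun kv : nat * V => (h kv.1, kv.2)) dD); apply.
  have hmax : forall k, (k < n)%N -> (h k < (h n).+1)%N by move=> k /hi; apply: ltnW.
  exists (h n).+1; split.
    move=> s t st; rewrite /=; apply: (nP (s \o h) (t \o h)) => k kn; apply: st.
    exact: hmax.
  have [N NP] := lim_ge D lD.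
  have [_] := iter_lim_reindex US U0 Uge nP hi hmax; apply.
  have mn k : (k < n)%N -> (k < maxn n N)%N by move=> kn; rewrite leq_max kn.
  have [+ _] := iter_lim_reindex US U0 Uge (h := id) nP (fun k l => id) mn; apply.
  by apply: NP; rewrite leq_maxr.
move=> D dD Ds; apply: limP => //; have [n nP] := dep D dD.
by exists n; split=> //; apply: iter_lim_incr.
Qed.

End Indiscernibles.

(** * Stable quotients *)

Section Stability.
Variables (K : Type) (L : language) (C C' : structure L) (iota : C -> C') (X : Type).
Hypotheses (mon : monster_over K iota) (X_small : small K X).
Variable P : set (X -> C').
Hypothesis P_tdef : type_definable iota P.

Implicit Types E : (X -> C') -> (X -> C') -> Prop.

Lemma monster_sum V W : small K V -> small K W -> small K (V + W)%type.
Proof.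
have [_ _ sl _ _] := mon.
by apply: ideal_sum; [exact: small_le|exact: small_set|exact: small_dir].
Qed.

Lemma monster_prod V W : small K V -> small K W -> small K (V * W)%type.
Proof.
have [_ _ sl _ _] := mon.
by apply: ideal_prod; [exact: small_le|exact: small_set|exact: small_dir].
Qed.

Lemma monster_nat : small K nat.
Proof. by have [] := mon. Qed.

(** By compactness some point of [D] has a second half of the same type over C as [w], and
    homogeneity moves this half to [w]. *)
Lemma type_definable_ex V W (D : set (V + W -> C')) : small K V -> small K W ->
  type_definable iota D -> type_definable iota [set w | exists v, D (copair v w)].
Proof.
move=> sV sW tD w wP.
pose J := ({F | definable iota F /\ D `<=` F} + {G | definable iota G /\ G w})%type.
pose FJ (j : J) : set (V + W -> C') := match j with inl F => proj1_sig F
  | inr G => [set z : V + W -> C' | proj1_sig G (z \o inr)] end.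
have [|l|z zP] := definable_compact mon (F := FJ) (monster_sum sV sW).
- by move=> [[F [dF DF]]|[G [dG Gw]]] //=; apply: (definable_preim inr).
- pose F := [set z | forall j, List.In j l -> (if j is inl _ then FJ j else [set _ | True]) z].
  have dF : definable iota F.
    by apply: definable_all_seq => -[[G [dG DG]]|G] //= _; apply: definable_true.
  have DF : D `<=` F by move=> z Dz -[[G [dG DG]]|//] _; apply: DG.
  have [|v vP] := wP _ (definable_ex dF); first by move=> z [v /DF h]; exists v.
  exists (copair v w) => -[j|[G [dG Gw]]] /= jl; first exact: (vP (inl j)).
  exact: Gw.
have Dz : D z by apply: tD => F dF DF; apply: (zP (inl (exist _ F (conj dF DF)))).
have /(tp_eq_conj mon sW)[sigma aut sz] : tp_eq iota (z \o inr) w.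
  apply: tp_eq_sym => G dG Gw; exact: (zP (inr (exist _ G (conj dG Gw)))).
exists (sigma \o (z \o inl)); rewrite -sz.
suff -> : copair (sigma \o (z \o inl)) (sigma \o (z \o inr)) = sigma \o z.
  by apply/(type_definable_aut _ tD aut).
by apply/funext => -[].
Qed.

Definition type_definable2 E : Prop := type_definable iota [set u : X + X -> C' | E (u \o inl) (u \o inr)].

Lemma type_definable2_aut E sigma a b : type_definable2 E -> automorphism_over iota sigma ->
  E (sigma \o a) (sigma \o b) <-> E a b.
Proof. by move=> tE aut; apply: (type_definable_aut (copair a b) tE aut). Qed.

Lemma type_definable2_preim E V (f g : X -> V) : type_definable2 E -> type_definable iota [set u : V -> C' | E (u \o f) (u \o g)].
Proof. by move=> tE; exact: (type_definable_preim (r := copair f g) tE). Qed.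

Lemma type_definable_bool V (b : bool) (D : set (V -> C')) : type_definable iota D -> type_definable iota [set u | b -> D u].
Proof. by move=> tD; apply: (type_definable_all (D := fun _ : b => D)). Qed.

Lemma extract_type_definable V (u : nat -> V -> C') : small K V ->
  exists2 u', indiscernible_seq iota u' & forall D, type_definable iota D ->
    (forall s, incr s -> D (env (u \o s))) -> D (env u').
Proof.
move=> sV; have [u' ru uP] := extract_indiscernible mon u sV; exists u' => // D tD Ds.
by apply: tD => F dF DF; apply: uP => // s /Ds; apply: DF.
Qed.

(** Stability of [P/E], tested on indiscernible sequences of representatives. *)
Definition rep_stable E : Prop := forall Y (u : nat -> X + Y -> C'), small K Y ->
  (forall i, P (u i \o inl)) -> indiscernible_seq iota u ->
  exists2 sigma, automorphism_over iota sigma &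
    E (sigma \o (u 1 \o inl)) (u 0 \o inl) /\ sigma \o (u 0 \o inr) = u 1 \o inr.

Lemma rep_stable_coarser E E' : (forall a b, E a b -> E' a b) -> rep_stable E -> rep_stable E'.
Proof.
move=> EE' sE Y u sY uP ru; have [sigma aut [h1 h2]] := sE Y u sY uP ru.
by exists sigma => //; split=> //; apply: EE'.
Qed.

(** Links [indiscernible], which uses finite increasing tuples, with [indiscernible_seq], which uses
    increasing maps of nat. *)
Lemma incr_extend n (i : 'I_n -> nat) : (forall k l : 'I_n, (k < l)%N -> (i k < i l)%N) ->
  exists2 h, incr h & forall k : 'I_n, h k = i k.
Proof.
move=> hi; pose M := \max_(k < n) i k.
have iM (k : 'I_n) : (i k <= M)%N by apply: (leq_bigmax (F := i)).
exists (fun k => if insub k is Some j then i j else (M + k).+1) => [k l kl|k]; last first.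
  by rewrite valK.
case: insubP => [j _ jk|kn]; case: insubP => [j' _ jl|ln].
- by apply: hi; rewrite jk jl.
- by have := iM j; lia.
- by have := ltn_ord j'; rewrite jl; lia.
- by lia.
Qed.

Lemma class_image E a sigma : type_definable2 E -> automorphism_over iota sigma ->
  [set sigma \o x | x in [set b | E a b]] = [set b | E (sigma \o a) b].
Proof.
move=> tE aut; have [tau [taut st ts]] := automorphism_over_inv aut.
apply/seteqP; split=> [_ [b ab <-]|b ab] /=; first by apply/type_definable2_aut.
have E1 (c : X -> C') : sigma \o (tau \o c) = c by apply/funext => x /=.
by exists (tau \o b); rewrite ?E1 //=; apply/(type_definable2_aut _ _ tE aut); rewrite E1.
Qed.

(** The classes of an indiscernible sequence of representatives form an indiscernible sequence of
    classes. *)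
Lemma stable_quotient_rep_stable E : equivalence_on P E -> type_definable2 E ->
  stable_quotient iota K P E -> rep_stable E.
Proof.
move=> [_ Er Es Et] tE sE Y u sY uP ru.
have [||||sigma [aut h]] := sE Y (fun i => [set b | E (u i \o inl) b]) (fun i => u i \o inr) _ _ _ 1 0.
- exact/card_ltTE.
- by move=> i; exists (u i \o inl).
- move=> n i j /incr_extend[h hi hE] /incr_extend[g gi gE].
  have sV : small K (nat * (X + Y))%type.
    by apply: monster_prod monster_nat _; apply: monster_sum.
  have [sigma aut sgm] := tp_eq_conj mon sV
    (tp_eq_trans (tp_eq_sym (indiscernible_seq_tp_eq ru hi)) (indiscernible_seq_tp_eq ru gi)).
  exists sigma; split=> // k.
  have sk : sigma \o u (i k) = u (j k).
    by apply/funext => v; have := congr1 (@^~ (val k, v)) sgm; rewrite /env /= hE gE.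
  by rewrite /= class_image // -sk.
- by [].
have [h1 h2] := h tt; exists sigma => //; split=> //.
have : [set sigma \o a | a in [set b | E (u 1 \o inl) b]] (sigma \o (u 1 \o inl)).
  by exists (u 1 \o inl) => //; apply: Er.
by rewrite h1 => /Es.
Qed.

(** Representatives of an indiscernible sequence of classes need not be indiscernible. From them a
    sequence [u'] is extracted; by [tau_ex] its first two terms are conjugate over C, up to [E], to
    the terms [i] and [j] of the given one, and stability is transported from [u']. *)
Lemma rep_stable_stable_quotient E : equivalence_on P E -> type_definable2 E ->
  rep_stable E -> stable_quotient iota K P E.
Proof.
move=> [EP Er Es Et] tE sE Y q b /card_ltTE sY qE ind.
have Ea sigma x y : automorphism_over iota sigma -> E x y -> E (sigma \o x) (sigma \o y).
  by move=> aut; apply: (type_definable2_aut _ _ tE aut).2.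
have /choice[a aP] : forall i, exists a, P a /\ q i = [set b | E a b].
  by move=> i; have [a Pa qa] := qE i; exists a.
pose u i := copair (a i) (b i).
have sXY := monster_sum X_small sY.
have [u' ru' u'P] := extract_type_definable u sXY.
have Pu' i : P (u' i \o inl).
  have := u'P [set w : nat * (X + Y) -> C' | P (w \o (fun x : X => (i, inl x)))].
  apply; first exact: (type_definable_preim (r := fun x : X => (i, inl x) : nat * (X + Y)) P_tdef).
  by move=> s _; have [] := aP (s i).
have [sigma saut [sE1 sb]] := sE Y u' sY Pu' ru'.
have tau_ex i j : (i < j)%N -> exists2 tau, automorphism_over iota tau &
    [/\ E (tau \o (u' 0 \o inl)) (a i), E (tau \o (u' 1 \o inl)) (a j),
        tau \o (u' 0 \o inr) = b i & tau \o (u' 1 \o inr) = b j].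
  move=> ij.
  (* After a change of points within their classes, the first two terms get the type of the terms
     [i] and [j]. This holds for every increasing pair of the given sequence and is type-definable
     once the new points are quantified, so it passes to [u']. *)
  pose D := [set w : (X + X) + (nat * (X + Y)) -> C' |
    [/\ E (fun x => w (inl (inl x))) (fun x => w (inr (0, inl x))),
        E (fun x => w (inl (inr x))) (fun x => w (inr (1, inl x))) &
        tp_eq iota (copair (copair (a i) (a j)) (copair (b i) (b j)))
          (w \o (fun s : (X + X) + (Y + Y) => match s with
             | inl x => inl x | inr (inl y) => inr (0, inr y) | inr (inr y) => inr (1, inr y) end))]].
  have tD : type_definable iota D.
    have t1 := type_definable2_preim (f := fun x : X => inl (inl x) : (X + X) + (nat * (X + Y)))
      (g := fun x => inr (0, inl x)) tE.
    have t2 := type_definable2_preim (f := fun x : X => inl (inr x) : (X + X) + (nat * (X + Y)))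
      (g := fun x => inr (1, inl x)) tE.
    have t3 := type_definable_preim (r := fun s : (X + X) + (Y + Y) => match s with
             | inl x => inl x | inr (inl y) => inr (0, inr y)
             | inr (inr y) => inr (1, inr y) end : (X + X) + (nat * (X + Y)))
      (type_definable_tp (iota := iota) (u := copair (copair (a i) (a j)) (copair (b i) (b j)))).
    move=> w wP; have [F dF DF|w1 [w2 w3]] := type_definable_and t1 (type_definable_and t2 t3) (u := w).
      by apply: wP => // z [z1 z2 z3]; apply: DF.
    by split; [exact: w1|exact: w2|exact: w3].
  have sn := monster_prod monster_nat sXY.
  have := type_definable_ex (monster_sum X_small X_small) sn tD.
  move=> /u'P; case=> [s si|x [x1 x2 x3]].
    have ord2 (k l : nat) : (k < l)%N -> forall k' l' : 'I_2, (k' < l')%N ->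
        ((if val k' is 0 then k else l) < (if val l' is 0 then k else l))%N.
      by move=> kl [[|[|//]] hk] [[|[|//]] hl].
    have [tau [taut th]] := ind 2 _ _ (ord2 _ _ (si 0 1 isT)) (ord2 _ _ ij).
    have [h01 h02] := th ord0; have [h11 h12] := th ord_max.
    have [rho [raut tr rt]] := automorphism_over_inv taut.
    have rE (c : X -> C') : rho \o (tau \o c) = c by apply/funext => x /=.
    exists (copair (rho \o a i) (rho \o a j)); split.
    - rewrite -/(a (s 0)); apply: Es; rewrite -[X in E X]rE; apply: Ea => //.
      move: h01; rewrite /= (aP (s 0)).2 (aP i).2 class_image // => h.
      have : [set b | E (a i) b] (a i) by apply: Er (aP i).1.
      by rewrite -h => h'; exact: h'.
    - rewrite -/(a (s 1)); apply: Es; rewrite -[X in E X]rE; apply: Ea => //.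
      move: h11; rewrite /= (aP (s 1)).2 (aP j).2 class_image // => h.
      have : [set b | E (a j) b] (a j) by apply: Er (aP j).1.
      by rewrite -h => h'; exact: h'.
    - have := tp_eq_aut (u := copair (copair (a i) (a j)) (copair (b i) (b j))) raut.
      congr tp_eq; apply/funext => -[[x|x]|[y|y]] //=; rewrite /env /=.
        by rewrite -(h02 : tau \o b (s 0) = b i) /= tr.
      by rewrite -(h12 : tau \o b (s 1) = b j) /= tr.
  have sV := monster_sum (monster_sum X_small X_small) (monster_sum sY sY).
  have [tau taut tx] := tp_eq_conj mon sV (tp_eq_sym x3).
  have txE v := congr1 (@^~ v) tx.
  have a0 : tau \o (x \o inl) = a i by apply/funext => z; exact: (txE (inl (inl z))).
  have a1 : tau \o (x \o inr) = a j by apply/funext => z; exact: (txE (inl (inr z))).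
  have b0 : tau \o (u' 0 \o inr) = b i by apply/funext => z; exact: (txE (inr (inl z))).
  have b1 : tau \o (u' 1 \o inr) = b j by apply/funext => z; exact: (txE (inr (inr z))).
  exists tau => //; split=> //.
    rewrite -a0; apply: (Ea _ _ _ taut); apply: Es; exact: x1.
  rewrite -a1; apply: (Ea _ _ _ taut); apply: Es; exact: x2.
have main i j : (i < j)%N -> exists2 rho, automorphism_over iota rho &
    E (rho \o a j) (a i) /\ rho \o b i = b j.
  move=> /tau_ex[tau taut [t1 t2 t3 t4]].
  have [tau' [taut' tt' t't]] := automorphism_over_inv taut.
  exists (tau \o sigma \o tau').
    by apply: automorphism_over_comp taut'; apply: automorphism_over_comp.
  split; last first.
    by rewrite -t4 -sb -t3; apply/funext => z /=; rewrite tt'.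
  have t'j : tau' \o (tau \o (u' 1 \o inl)) = u' 1 \o inl by apply/funext => z /=.
  have h1 : E (tau' \o a j) (u' 1 \o inl).
    by apply: Es; rewrite -t'j; apply: (Ea _ _ _ taut').
  have h2 : E (sigma \o (tau' \o a j)) (u' 0 \o inl).
    by apply: Et sE1; apply: (Ea _ _ _ saut).
  by apply: Et t1; exact: (Ea _ _ _ taut h2).
have E_class sigma' i j : automorphism_over iota sigma' -> E (sigma' \o a i) (a j) ->
    [set sigma' \o x | x in q i] = q j.
  move=> aut h; rewrite (aP i).2 (aP j).2 class_image //; apply/seteqP; split=> x xE.
    exact: Et (Es _ _ h) xE.
  exact: Et h xE.
move=> i j; have [/main[rho raut [rE rb]] _|ji|ij /(_ ij)//] := ltngtP i j; last first.
  have [rho raut [rE rb] _] := main _ _ ji.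
  by exists rho; split=> // _; split=> //; apply: E_class.
have [rho' [raut' rr' r'r]] := automorphism_over_inv raut.
exists rho'; split=> // _; split.
  apply: E_class => //; apply: Es; have := Ea _ _ _ raut' rE.
  by have -> : rho' \o (rho \o a j) = a j by apply/funext => z /=.
by rewrite -rb; apply/funext => z /=.
Qed.

End Stability.

(** * Intersections of stable relations *)

Section Intersections.
Variables (K : Type) (L : language) (C C' : structure L) (iota : C -> C') (X : Type).
Hypotheses (mon : monster_over K iota) (X_small : small K X).
Variable P : set (X -> C').
Hypothesis P_tdef : type_definable iota P.

Implicit Types E : (X -> C') -> (X -> C') -> Prop.

(** Types over C are orbits, so for stability it suffices to find anywhere two equivalent points and
    a tuple [y] to which one is related as [u 1] to [u 0] and the other as [u 0] to [u 1]. *)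
Lemma swap_transfer E Y (u : nat -> X + Y -> C') (x x0 : X -> C') (y : Y -> C') :
  small K Y -> type_definable2 iota E ->
  tp_eq iota (copair (u 1 \o inl) (u 0 \o inr)) (copair x y) ->
  tp_eq iota (copair (u 0 \o inl) (u 1 \o inr)) (copair x0 y) -> E x x0 ->
  exists2 sigma, automorphism_over iota sigma &
    E (sigma \o (u 1 \o inl)) (u 0 \o inl) /\ sigma \o (u 0 \o inr) = u 1 \o inr.
Proof.
move=> sY tE t1 t2 Exx0; have sXY := monster_sum mon X_small sY.
have [rho raut rE] := tp_eq_conj mon sXY (tp_eq_sym t2).
have t3 : tp_eq iota (copair (u 1 \o inl) (u 0 \o inr)) (copair (rho \o x) (u 1 \o inr)).
  apply: tp_eq_trans t1 _; have := tp_eq_aut (u := copair x y) raut.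
  congr tp_eq; apply/funext => -[z|z] //=; exact: (congr1 (@^~ (inr z)) rE).
have [sigma saut sE] := tp_eq_conj mon sXY t3; exists sigma => //; split.
  have -> : sigma \o (u 1 \o inl) = rho \o x.
    by apply/funext => z; exact: (congr1 (@^~ (inl z)) sE).
  have -> : u 0 \o inl = rho \o x0.
    by apply/funext => z; exact: (esym (congr1 (@^~ (inl z)) rE)).
  exact/(type_definable2_aut _ _ tE raut).
by apply/funext => z; exact: (congr1 (@^~ (inr z)) sE).
Qed.

(** By stability, the class of [u i] modulo [E] moves across the block of the
    next [n - i] parameters without changing the type over [C]. *)
Lemma cross_block E Y (u : nat -> X + Y -> C') n i : small K Y ->
  equivalence_on P E -> type_definable2 iota E -> rep_stable K iota P E ->
  (forall i, P (u i \o inl)) -> indiscernible_seq iota u -> (i <= n)%N ->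
  exists a : X -> C', E a (u n \o inl) /\ forall k, (k < n)%N ->
    tp_eq iota (if (k < i)%N then copair (u 1 \o inl) (u 0 \o inr)
               else copair (u 0 \o inl) (u 1 \o inr)) (copair a (u k \o inr)).
Proof.
move=> sY [EP Er Es Et] tE sE uP ru le_in.
(* The block [m] has its point at index i + m(n+1), followed by the parameters from [i] on; the
   parameters below [i] are the same in all blocks, so that [sigma] fixes them. *)
pose pos m k := (if (k < i)%N then k else i + m * n.+1 + 1 + k)%N.
pose r (s : nat * (X + 'I_n * Y)) : nat * (X + Y) := match s.2 with
  | inl x => ((i + s.1 * n.+1)%N, inl x) | inr ky => (pos s.1 ky.1, inr ky.2) end.
have sO : small K 'I_n.
  have [_ _ _ sn _] := mon; apply: small_le sn; exists val; exact: val_inj.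
have rU : indiscernible_seq iota (fun m w => env u (r (m, w))).
  apply: indiscernible_seq_reindex ru _ => h hi.
  exists (fun j => if (j < i)%N then j else (i + h ((j - i) %/ n.+1) * n.+1 + (j - i) %% n.+1)%N).
    move=> k l kl /=; case: (ltnP k i) => ki; case: (ltnP l i) => li //; try lia.
    have := leq_div2r n.+1 (leq_sub2r i (ltnW kl)).
    rewrite leq_eqVlt => /orP[/eqP e|/hi ab].
      have := divn_eq (k - i) n.+1; have := divn_eq (l - i) n.+1; rewrite e.
      by move: (_ %/ _) (_ %% _) (_ %% _) => A p q; lia.
    have := ltn_pmod (k - i) (ltn0Sn n); rewrite -ltnS in ab.
    have : ((h ((k - i) %/ n.+1)).+1 * n.+1 <= h ((l - i) %/ n.+1) * n.+1)%N.
      by rewrite leq_mul2r -ltnS ab orbT.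
    move: (h _) (h _) (_ %% _) (_ %% _) => A B p q; lia.
  move=> m [x|[k y]]; rewrite /r /=.
    rewrite ltnNge leq_addr /= addKn mulnK // modnMl addn0 //.
  rewrite /pos; case: (ltnP k i) => ki; first by rewrite ki.
  have kn := ltn_ord k.
  have -> : (i + m * n.+1 + 1 + k < i)%N = false by apply/negP; lia.
  have -> : (i + m * n.+1 + 1 + k - i = m * n.+1 + k.+1)%N by lia.
  rewrite divnMDl // modnMDl divn_small ?modn_small ?ltnS // addn0; congr pair; lia.
have [|sigma saut [sE1 sE2]] := sE _ _ (monster_prod mon sO sY) _ rU.
  by move=> m; exact: (uP (i + m * n.+1)%N).
have [tau [taut st ts]] := automorphism_over_inv saut.
(* Below [n] these are the parameters of block 0, and at [n] the point of block 1; contracting along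
   [h] restores the indices of the statement. *)
pose h k := (if (k < i)%N then k else i + 1 + k)%N.
have hi : incr h by move=> k l; rewrite /h; case: (ltnP k i); case: (ltnP l i); lia.
have sV := monster_prod mon (monster_nat mon) (monster_sum mon X_small sY).
have [rho raut rE] := tp_eq_conj mon sV (tp_eq_sym (indiscernible_seq_tp_eq ru hi)).
have rEk k : rho \o u (h k) = u k by apply/funext => v; exact: (congr1 (@^~ (k, v)) rE).
exists (rho \o (tau \o (u i \o inl))); split.
  have hn : h n = (i + 1 * n.+1)%N by rewrite /h ltnNge le_in /=; lia.
  have sE3 : E (u (h n) \o inl) (tau \o (u i \o inl)).
    apply/(type_definable2_aut _ _ tE saut).
    have -> : sigma \o (tau \o (u i \o inl)) = u i \o inl by apply/funext => z /=.
    have -> : u i = u (i + 0 * n.+1)%N by rewrite mul0n addn0.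
    rewrite hn; exact: sE1.
  have -> : u n \o inl = rho \o (u (h n) \o inl) by rewrite -(rEk n).
  by apply: Es; apply/(type_definable2_aut _ _ tE raut).
move=> k kn.
have uk : u k \o inr = rho \o (tau \o (u (pos 1 k) \o inr)).
  rewrite -(rEk k); apply/funext => y /=; congr (rho _).
  have := congr1 (@^~ (Ordinal kn, y)) sE2; rewrite /env /r /= => e.
  have -> : h k = pos 0 k by rewrite /h /pos; case: ltnP => //; lia.
  by rewrite -(st (u (pos 0 k) (inr y))) e.
have -> : copair (rho \o (tau \o (u i \o inl))) (u k \o inr) =
    rho \o (tau \o copair (u i \o inl) (u (pos 1 k) \o inr)).
  by rewrite uk; apply/funext => -[].
apply: tp_eq_trans _ (tp_eq_aut raut); apply: tp_eq_trans _ (tp_eq_aut taut).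
pose sw (s : X + Y) : (X + Y) + (X + Y) := match s with inl x => inr (inl x) | inr y => inl (inr y) end.
pose st' (s : X + Y) : (X + Y) + (X + Y) := match s with inl x => inl (inl x) | inr y => inr (inr y) end.
rewrite /pos; case: (ltnP k i) => ki.
  have := tp_eq_preim (r := sw) (indiscernible_seq_pair ru (isT : (0 < 1)%N) ki).
  by congr tp_eq; apply/funext => -[].
have lt : (i < i + 1 * n.+1 + 1 + k)%N by lia.
have := tp_eq_preim (r := st') (indiscernible_seq_pair ru (isT : (0 < 1)%N) lt).
by congr tp_eq; apply/funext => -[].
Qed.

(** By [cross_block] and compactness there are infinitely many points in a single class of [E1]
    whose position relative to the parameters is that of the points of [u]. It remains to apply
    stability of [E2] while staying in this class. *)
Lemma rep_stable_and E1 E2 : equivalence_on P E1 -> equivalence_on P E2 ->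
  type_definable2 iota E1 -> type_definable2 iota E2 -> rep_stable K iota P E1 -> rep_stable K iota P E2 ->
  rep_stable K iota P (fun a b => E1 a b /\ E2 a b).
Proof.
move=> e1 e2 tE1 tE2 sE1 sE2 Y u sY uP ru.
have [EP1 Er1 Es1 Et1] := e1; have [EP2 Er2 Es2 Et2] := e2.
have sXY := monster_sum mon X_small sY.
have sV := monster_prod mon (monster_nat mon) sXY.
pose F (ij : nat * nat) := [set w : nat * (X + Y) -> C' |
  E1 (w \o (fun x => (ij.1, inl x))) (w \o (fun x => (ij.2, inl x))) /\
  ((ij.2 < ij.1)%N -> tp_eq iota (copair (u 1 \o inl) (u 0 \o inr))
     (w \o (fun s : X + Y => match s with inl x => (ij.1, inl x) | inr y => (ij.2, inr y) end))) /\
  ((ij.1 < ij.2)%N -> tp_eq iota (copair (u 0 \o inl) (u 1 \o inr))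
     (w \o (fun s : X + Y => match s with inl x => (ij.1, inl x) | inr y => (ij.2, inr y) end)))].
have tF ij : type_definable iota (F ij).
  apply: type_definable_and; first exact: (type_definable2_preim (f := fun x => (ij.1, inl x))).
  by apply: type_definable_and; apply: type_definable_bool; apply: (type_definable_preim (D := [set w | tp_eq iota _ w]));
     apply: type_definable_tp.
have [l|w wF] := type_definable_compact mon sV tF.
  have [n nl] : exists n, forall ij, List.In ij l -> (ij.1 < n)%N && (ij.2 < n)%N.
    elim: l => [|ij l [n IH]]; first by exists 0.
    exists (maxn n (maxn ij.1 ij.2).+1) => ij' /= [<-|/IH]; lia.
  have /choice[a aP] : forall i, exists a, (i <= n)%N -> E1 a (u n \o inl) /\
      forall k, (k < n)%N -> tp_eq iota (if (k < i)%N then copair (u 1 \o inl) (u 0 \o inr)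
               else copair (u 0 \o inl) (u 1 \o inr)) (copair a (u k \o inr)).
    move=> i; have [le_in|] := leqP i n; last by exists (u 0 \o inl).
    by have [a aP] := cross_block sY e1 tE1 sE1 uP ru le_in; exists a.
  exists (fun kv => match kv.2 with inl x => a kv.1 x | inr y => u kv.1 (inr y) end).
  move=> [i j] /nl /= /andP[i_n j_n].
  have [ai1 ai2] := aP i (ltnW i_n); have [aj1 _] := aP j (ltnW j_n).
  split; first exact: Et1 ai1 (Es1 _ _ aj1).
  have := ai2 _ j_n; set c := copair (a i) _; rewrite /=.
  have -> : c = (fun kv : nat * (X + Y) => match kv.2 with inl x => a kv.1 x
    | inr y => u kv.1 (inr y) end) \o (fun s : X + Y => match s with
    | inl x => (i, inl x) | inr y => (j, inr y) end) by apply/funext => -[].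
  move=> h; split=> ij; move: h; first by rewrite ij.
  by rewrite ltnNge ltnW.
have [v rv vP] := extract_type_definable mon (fun i x => w (i, x)) sXY.
have vF i j : F (i, j) (env v).
  apply: vP => // s si; have [h1 [h2 h3]] := wF (s i, s j); split=> //.
  by split=> ij; [have := h2 (si _ _ ij)|have := h3 (si _ _ ij)];
     congr tp_eq; apply/funext => -[].
have Pv i : P (v i \o inl) by have [/EP1[]] := vF i i.
(* The point of [v 0] becomes a constant parameter, fixed by [sigma]; the other points are
   [E1]-equivalent to it, hence so are their images. *)
pose r (s : nat * (X + (Y + X))) : nat * (X + Y) := match s.2 with
  | inl x => (s.1.+1, inl x) | inr (inl y) => (s.1.+1, inr y) | inr (inr x) => (0, inl x) end.
have rU : indiscernible_seq iota (fun m z => env v (r (m, z))).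
  apply: indiscernible_seq_reindex rv _ => h hi; exists (fun j => if j is k.+1 then (h k).+1 else 0).
    by move=> [|k] [|l] // kl; rewrite /= ltnS; apply: hi.
  by move=> m [x|[y|x]].
have [|sigma saut [sE sb]] := sE2 _ _ (monster_sum mon sY X_small) _ rU.
  by move=> m; exact: (Pv m.+1).
have sbE z := congr1 (@^~ z) sb.
apply: (@swap_transfer (fun a b => E1 a b /\ E2 a b) Y u (sigma \o (v 2 \o inl)) (v 1 \o inl) (v 2 \o inr)) => //.
- exact: type_definable_and.
- have [_ [/(_ isT) h _]] := vF 2 1; apply: tp_eq_trans h _.
  have := tp_eq_aut (u := env v \o (fun s : X + Y => match s with inl x => (2, inl x)
      | inr y => (1, inr y) end)) saut.
  congr tp_eq; apply/funext => -[x|y] //=; exact: (sbE (inl y)).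
- have [_ [_ /(_ isT)]] := vF 1 2.
  by congr tp_eq; apply/funext => -[].
split=> //; apply: (@Et1 _ (v 0 \o inl)); last by have [] := vF 0 1.
have -> : v 0 \o inl = sigma \o (v 0 \o inl) by apply/funext => x; exact: (esym (sbE (inr x))).
by apply/(type_definable2_aut _ _ tE1 saut); have [] := vF 2 0.
Qed.

Definition bigcap_rel I (E : I -> (X -> C') -> (X -> C') -> Prop) : (X -> C') -> (X -> C') -> Prop :=
  fun a b => [/\ P a, P b & forall i, E i a b].

Lemma equivalence_bigcap I (E : I -> (X -> C') -> (X -> C') -> Prop) :
  (forall i, equivalence_on P (E i)) -> equivalence_on P (bigcap_rel E).
Proof.
move=> eE; split=> [a b []//|a Pa|a b [Pa Pb ab]|a b c [Pa Pb ab] [_ Pc bc]]; split=> // i;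
  have [EP Er Es Et] := eE i; [exact: Er|exact: Es|exact: Et (ab i) (bc i)].
Qed.

Lemma type_definable2_bigcap I (E : I -> (X -> C') -> (X -> C') -> Prop) :
  (forall i, type_definable2 iota (E i)) -> type_definable2 iota (bigcap_rel E).
Proof.
move=> tE w wP; split; [apply: P_tdef|apply: P_tdef|move=> i; apply: tE] => F dF FP.
- by apply: (wP [set u : X + X -> C' | F (u \o inl)]) => [|v [/FP]]; first exact: (definable_preim inl).
- by apply: (wP [set u : X + X -> C' | F (u \o inr)]) => [|v [_ /FP]]; first exact: (definable_preim inr).
- by apply: wP => // v [_ _ h]; apply: FP; apply: h.
Qed.

(** Compactness reduces to finite intersections, since each condition on the points wanted by
    [swap_transfer] involves at most one [E i]. *)
Lemma rep_stable_bigcap I (E : I -> (X -> C') -> (X -> C') -> Prop) :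
  (forall i, equivalence_on P (E i)) -> (forall i, type_definable2 iota (E i)) ->
  (forall i, rep_stable K iota P (E i)) -> rep_stable K iota P (bigcap_rel E).
Proof.
move=> eE tE sE; pose El (l : seq I) a b := [/\ P a, P b & forall i, List.In i l -> E i a b].
have sEl l : rep_stable K iota P (El l).
  elim: l => [|i l IH].
    move=> Y u sY uP ru.
    (* For the empty intersection it is enough to take the tuple of [u 0] to that of [u 1], which
       the shift does. *)
    have succ_incr : incr S by [].
    have sV := monster_prod mon (monster_nat mon) (monster_sum mon X_small sY).
    have [sigma saut sE'] := tp_eq_conj mon sV (indiscernible_seq_tp_eq ru succ_incr).
    exists sigma => //; split; first split=> //.
      exact/(type_definable_aut _ P_tdef saut).
    by apply/funext => y; exact: (congr1 (@^~ (0, inr y)) sE').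
  have El_and : forall a b, E i a b /\ El l a b -> El (i :: l) a b.
    by move=> a b [ab [Pa Pb h]]; split=> // j /= [<-|/h].
  apply: rep_stable_coarser El_and _; apply: rep_stable_and => //.
  - split=> [a b []//|a Pa|a b [Pa Pb ab]|a b c [Pa Pb ab] [_ Pc bc]]; split=> // j jl;
      have [EP Er Es Et] := eE j; [exact: Er|exact: Es (ab j jl)|exact: Et (ab j jl) (bc j jl)].
  - have -> : El l = bigcap_rel (fun j : {j | List.In j l} => E (sval j)).
      apply/funext => a; apply/funext => b; apply/propext; split=> -[Pa Pb h]; split=> //.
        by move=> [j jl]; apply: h.
      by move=> j jl; apply: (h (exist _ j jl)).
    exact: type_definable2_bigcap.
move=> Y u sY uP ru.
have sXY := monster_sum mon X_small sY.
pose F (o : option I) := [set w : X + (X + Y) -> C' | if o is Some i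
  then E i (w \o inl) (w \o (inr \o inl))
  else tp_eq iota (copair (u 1 \o inl) (u 0 \o inr))
         (w \o (fun s : X + Y => match s with inl x => inl x | inr y => inr (inr y) end)) /\
       tp_eq iota (copair (u 0 \o inl) (u 1 \o inr)) (w \o inr)].
have tF o : type_definable iota (F o).
  case: o => [i|]; first exact: (type_definable2_preim (f := inl) (g := inr \o inl)).
  by apply: type_definable_and; apply: (type_definable_preim (D := [set w | tp_eq iota _ w])); apply: type_definable_tp.
have [l|w wF] := type_definable_compact mon (monster_sum mon X_small sXY) tF.
  have [sigma saut [[P1 P2 sEl1] sb]] :=
    sEl (List.flat_map (fun o => if o is Some i then [:: i] else [::]) l) Y u sY uP ru.
  exists (copair (sigma \o (u 1 \o inl)) (copair (u 0 \o inl) (u 1 \o inr))) => -[i|] il.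
    by apply: sEl1; apply/List.in_flat_map; exists (Some i); split=> //; left.
  split; last by [].
  have := tp_eq_aut (u := copair (u 1 \o inl) (u 0 \o inr)) saut.
  congr tp_eq; apply/funext => -[x|y] //=; exact: (congr1 (@^~ y) sb).
have [w1 w2] := wF None.
apply: (@swap_transfer (bigcap_rel E) Y u (w \o inl) (w \o (inr \o inl)) (w \o (inr \o inr))) => //.
- exact: type_definable2_bigcap.
- by move: w1; congr tp_eq; apply/funext => -[].
- by move: w2; congr tp_eq; apply/funext => -[].
split=> [||i]; last exact: (wF (Some i)).
  have t1 : tp_eq iota (u 1 \o inl) (w \o inl).
    by have := tp_eq_preim (r := inl) w1; congr tp_eq; apply/funext => x.
  exact: type_definable_tp_eq P_tdef t1 (uP 1).
have t0 : tp_eq iota (u 0 \o inl) (w \o (inr \o inl)).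
  by have := tp_eq_preim (r := inl) w2; congr tp_eq; apply/funext => x.
exact: type_definable_tp_eq P_tdef t0 (uP 0).
Qed.

Lemma rel_type_definable_type_definable B E : rel_type_definable iota P B E -> type_definable2 iota E.
Proof.
move=> [pi piE] w wP; apply/piE; split; [apply: P_tdef|apply: P_tdef|] => [F dF FP|F dF FP|phi pphi].
- by apply: (wP [set u : X + X -> C' | F (u \o inl)]) => [|v /piE[/FP]]; first exact: (definable_preim inl).
- by apply: (wP [set u : X + X -> C' | F (u \o inr)]) => [|v /piE[_ /FP]]; first exact: (definable_preim inr).
have := wP [set u : X + X -> C' | sat (copair (copair (u \o inl) (u \o inr)) (iota \o set_val)) phi].
apply=> [|v /piE[_ _]]; last exact.
exists (rename (fun s : (X + X) + set_type B => match s with inl x => inl x | inr b => inr (set_val b) end) phi).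
move=> u /=; rewrite sat_rename.
suff -> : copair (copair (u \o inl) (u \o inr)) (iota \o set_val) = copair u iota \o
  (fun s : (X + X) + set_type B => match s with inl x => inl x | inr b => inr (set_val b) end) by [].
by apply/funext => -[[]|].
Qed.

End Intersections.

(** * Chains of entourages *)

Lemma iff_of_eq (A B : Prop) : A = B -> A <-> B.
Proof. by move=> ->. Qed.

Section Chains.
Variables (K : Type) (L : language) (C C' : structure L) (iota : C -> C') (X : Type).
Hypotheses (mon : monster_over K iota) (X_small : small K X).
Variable P : set (X -> C').
Hypothesis P_tdef : type_definable iota P.

Definition instance (theta : formula L ((X + X) + nat)) (c : nat -> C) (a b : X -> C') : Prop :=
  sat (copair (copair a b) (iota \o c)) theta.

(** Separates the shape of a formula from its parameters, indexed by nat; the number of shapes does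
    not depend on C. *)
Lemma definable_template V (F : set (V -> C')) : definable iota F ->
  exists (theta : formula L (V + nat)) (c : nat -> C),
    forall u, F u <-> sat (copair u (iota \o c)) theta.
Proof.
move=> [phi phiP]; have [n [v [psi phiE]]] := formula_finite phi.
have [c0] := carrier_inhabited C.
exists (rename (fun k => if v k is inl x then inl x else inr (val k)) psi).
exists (fun j => if insub j is Some k then (if v k is inr c then c else c0) else c0) => u.
rewrite phiP phiE !sat_rename; apply: iff_of_eq; congr sat; apply/funext => k /=.
by case E : (v k) => [x|c] //=; rewrite valK E.
Qed.

Lemma definable_instance theta c V (f g : X -> V) :
  definable iota [set u : V -> C' | instance theta c (u \o f) (u \o g)].
Proof.
exists (rename (fun s => match s with inl (inl x) => inl (f x) | inl (inr x) => inl (g x)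
  | inr k => inr (c k) end) theta) => u /=.
rewrite sat_rename /instance; apply: iff_of_eq; congr sat; by apply/funext => -[[]|].
Qed.

Lemma instance_aut theta c a b sigma : automorphism_over iota sigma ->
  instance theta c (sigma \o a) (sigma \o b) <-> instance theta c a b.
Proof.
move=> aut; have := definable_aut (copair a b) (definable_instance theta c inl inr) aut.
exact.
Qed.

(** [E] is transitive and is the intersection of the sets in [J], so by compactness finitely many of
    these have an intersection whose composition with itself, on [P], lies in [F]. Intersecting with
    the flipped set gives symmetry. *)
Lemma half_entourage E F : equivalence_on P E -> type_definable2 iota E ->
  definable iota F -> (forall a b, E a b -> F (copair a b)) ->
  exists theta c, [/\ forall a b, E a b -> instance theta c a b,
    forall a b, instance theta c a b -> instance theta c b a &
    forall a b d, P a -> P b -> P d -> instance theta c a b -> instance theta c b d ->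
      F (copair a d)].
Proof.
move=> [EP Er Es Et] tE dF EF.
pose J := {G : set (X + X -> C') | definable iota G /\ forall a b, E a b -> G (copair a b)}.
pose f12 : X + X -> X + (X + X) := copair inl (inr \o inl).
pose D (o : option J) := [set u : X + (X + X) -> C' | if o is Some G
  then sval G (u \o f12) /\ sval G (u \o inr)
  else P (u \o inl) /\ P (u \o (inr \o inl)) /\ P (u \o (inr \o inr))].
pose f13 : X + X -> X + (X + X) := copair inl (inr \o inr).
have [i||u uD|l lP] := @type_definable_compact_sub K L C C' iota mon (option J) _ D
  [set u : X + (X + X) -> C' | F (u \o f13)] (monster_sum mon X_small (monster_sum mon X_small X_small)).
- case: i => [[G [dG EG]]|].
    by apply: type_definable_defi; apply: definable_and; [exact: (definable_preim f12)|exact: (definable_preim inr)].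
  by apply: type_definable_and; [exact: (type_definable_preim (r := inl))|apply: type_definable_and;
    [exact: (type_definable_preim (r := inr \o inl))|exact: (type_definable_preim (r := inr \o inr))]].
- exact: (definable_preim f13).
- have tEE v : (forall G : J, sval G v) -> E (v \o inl) (v \o inr).
    move=> vG; apply: tE => G dG EG.
    have EG' a b : E a b -> G (copair a b) by move=> ab; apply: EG.
    exact: (vG (exist _ G (conj dG EG'))).
  have E1 := tEE (u \o f12) (fun G => (uD (Some G)).1).
  have E2 := tEE (u \o inr) (fun G => (uD (Some G)).2).
  have := EF _ _ (Et _ _ _ E1 E2).
  by rewrite /mkset; congr F; apply/funext => -[].
pose H := [set u | forall G, List.In G l -> (if G is Some G then sval G else [set _ | True]) u].
have dH : definable iota H.
  by apply: definable_all_seq => -[[G [dG EG]]|] // _; apply: definable_true.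
pose flip : X + X -> X + X := copair inr inl.
have dH2 : definable iota [set u | H u /\ H (u \o flip)].
  by apply: definable_and => //; exact: (definable_preim flip).
have [theta [c cP]] := definable_template dH2.
have EH a b : E a b -> H (copair a b).
  by move=> ab [[G [dG EG]]|] //= _; apply: EG.
have flipE (a b : X -> C') : copair a b \o flip = copair b a by apply/funext => -[].
have instE a b : instance theta c a b <-> H (copair a b) /\ H (copair b a).
  by rewrite /instance -cP /= flipE.
exists theta, c; split=> [a b ab|a b /instE[h1 h2]|a b d Pa Pb Pd /instE[h1 _] /instE[h2 _]].
- by apply/instE; split; apply: EH => //; apply: Es.
- exact/instE.
have := lP (copair a (copair b d)); rewrite /=.
have -> : copair a (copair b d) \o f13 = copair a d by apply/funext => -[].
apply=> -[[G GP]|] Gl //=.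
have -> : copair a (copair b d) \o f12 = copair a b by apply/funext => -[].
by split; [exact: (h1 (Some (exist _ G GP)))|exact: (h2 (Some (exist _ G GP)))].
Qed.

Variable tau : nat -> formula L ((X + X) + nat).

Definition chain_rel (c : nat -> nat -> C) (a b : X -> C') : Prop :=
  [/\ P a, P b & forall k, instance (tau k) (c k) a b].

Definition chain (c : nat -> nat -> C) : Prop :=
  [/\ forall k a, P a -> instance (tau k) (c k) a a,
      forall k a b, P a -> P b -> instance (tau k) (c k) a b -> instance (tau k) (c k) b a &
      forall k a b d, P a -> P b -> P d -> instance (tau k.+1) (c k.+1) a b ->
        instance (tau k.+1) (c k.+1) b d -> instance (tau k) (c k) a d].

Lemma chain_mono c k j a b : chain c -> P a -> P b ->
  instance (tau (k + j)) (c (k + j)) a b -> instance (tau k) (c k) a b.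
Proof.
move=> [cr cs ct] Pa Pb; elim: j => [|j IH]; first by rewrite addn0.
by rewrite addnS => h; apply: IH; apply: (ct _ _ b) => //; apply: cr.
Qed.

Lemma chain_equivalence c : chain c -> equivalence_on P (chain_rel c).
Proof.
move=> [cr cs ct]; split=> [a b []//|a Pa|a b [Pa Pb ab]|a b d [Pa Pb ab] [_ Pd bd]]; split=> // k.
- exact: cr.
- exact: cs.
- by apply: (ct _ _ b).
Qed.

Lemma chain_type_definable2 c : type_definable2 iota (chain_rel c).
Proof.
move=> w wP; split; [apply: P_tdef|apply: P_tdef|] => [F dF FP|F dF FP|k].
- by apply: (wP [set u : X + X -> C' | F (u \o inl)]) => [|v [/FP]]; first exact: (definable_preim inl).
- by apply: (wP [set u : X + X -> C' | F (u \o inr)]) => [|v [_ /FP]]; first exact: (definable_preim inr).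
- apply: (wP [set u : X + X -> C' | instance (tau k) (c k) (u \o inl) (u \o inr)]) => [|v [_ _]]; last exact.
  exact: definable_instance.
Qed.

Fixpoint spath (S : (X -> C') -> (X -> C') -> Prop) n (a b : X -> C') : Prop :=
  if n is m.+1 then exists d, [/\ P d, spath S m a d & S d b] else a = b.

(** Each step costs one level. Hence the level [l + 2 + N] in [independent_bound]: paths have at
    most [N] steps, and two more levels serve to join three steps into one. *)
Lemma chain_spath c l n m a b : chain c -> (m <= n)%N -> P a -> P b ->
  spath (instance (tau (l + n)) (c (l + n))) m a b -> instance (tau l) (c l) a b.
Proof.
move=> ch; have [cr cs ct] := ch; elim: n l m b => [|n IH] l [|m] b //= mn Pa Pb.
- by move=> <-; apply: cr.
- by move=> <-; apply: cr.
move=> [d [Pd ad db]]; apply: (ct _ _ d) => //.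
  by apply: (IH l.+1 m) => //; rewrite addSnnS.
by apply: (chain_mono (j := n)) => //; rewrite addSnnS.
Qed.

Lemma spath_aut S n a b sigma : automorphism_over iota sigma ->
  (forall a b, S a b -> S (sigma \o a) (sigma \o b)) ->
  spath S n a b -> spath S n (sigma \o a) (sigma \o b).
Proof.
move=> aut Sa; elim: n b => [|n IH] b /=; first by move=> ->.
move=> [d [Pd ad db]]; exists (sigma \o d); split; [|exact: IH|exact: Sa].
exact/(type_definable_aut _ P_tdef aut).
Qed.

Hypothesis P_complete : forall a b, P a -> P b -> tp_eq iota a b.

(** Writing [a i = g i o] for automorphisms [g i] over [C], the product of the
    [g i] with [i \notin I], applied to [o], is close to [o] for the [j]-th
    entourage exactly when [j \in I], so that a large [N] contradicts NIP. *)
Lemma independent_bound l N (c : nat -> nat -> nat -> C) (a : nat -> X -> C') (o : X -> C') :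
  (forall (d : nat -> nat -> C') (alpha : set nat -> X + X -> C'),
    ~ forall i I, (i < N)%N -> (sat (copair (alpha I) (d i)) (tau (l + 2)) <-> I i)) ->
  (forall i, (i < N)%N -> chain (c i)) -> P o -> (forall i, (i < N)%N -> P (a i)) ->
  (forall i j, (i < N)%N -> (j < N)%N -> i != j ->
     instance (tau (l + 2 + N)) (c j (l + 2 + N)) (a i) o) ->
  exists2 i, (i < N)%N & instance (tau l) (c i l) (a i) o.
Proof.
move=> nip ch Po Pa ind; apply: contrapT => nex.
have /choice[g gP] : forall i, exists g, (i < N)%N ->
    automorphism_over iota g /\ g \o o = a i.
  move=> i; have [iN|] := pselect (i < N)%N; last by exists id.
  by have [g gaut go] := tp_eq_conj mon X_small (P_complete Po (Pa i iN)); exists g.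
pose act w := foldr (fun i s => g i \o s) id w.
have act_aut w : all (gtn N) w -> automorphism_over iota (act w).
  elim: w => [_|i w IH /= /andP[iN /IH ih]]; first by split=> //; exact: automorphism_id.
  by apply: automorphism_over_comp => //; have [] := gP i iN.
have act_cat w w' : act (w ++ w') = act w \o act w' by elim: w => //= i w ->.
have Pact w : all (gtn N) w -> P (act w \o o).
  by move=> /act_aut aut; apply/(type_definable_aut _ P_tdef aut).
(* [g i] carries the path from the image of [o] under [act w] to [o] to a path ending at [a i],
   which is one step away from [o]. *)
have claim1 w j : all (gtn N) w -> (j < N)%N -> j \notin w ->
    spath (instance (tau (l + 2 + N)) (c j (l + 2 + N))) (size w) (act w \o o) o.
  elim: w => [//|i w IH /= /andP[iN wN]] jN; rewrite inE negb_or => /andP[ji jw].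
  have [gaut go] := gP i iN; exists (a i); split; first exact: Pa.
    rewrite -go; apply: (@spath_aut _ _ (act w \o o) o (g i) gaut) => [x y xy|].
      exact/(instance_aut _ _ _ _ gaut).
    exact: IH.
  by apply: ind => //; rewrite eq_sym.
have claim1' w j : all (gtn N) w -> (j < N)%N -> j \notin w -> (size w <= N)%N ->
    instance (tau (l + 2)) (c j (l + 2)) (act w \o o) o.
  move=> wN jN jw sw; apply: (chain_spath (n := N) (m := size w)) => //.
  - exact: ch.
  - exact: Pact.
  - exact: claim1.
have := nip (fun i => iota \o c i (l + 2))
  (fun I => copair (act [seq i <- seq.iota 0 N | ~~ `[< I i >]] \o o) o).
apply=> j I jN.
rewrite -/(instance _ _ _ _); set w := [seq _ <- _ | _].
have wN : all (gtn N) w by apply/allP => i; rewrite mem_filter mem_iota => /andP[_].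
have sw : (size w <= N)%N by rewrite -[leqRHS](size_iota 0 N) size_filter count_size.
have uw : uniq w by rewrite filter_uniq // iota_uniq.
split=> [h|Ij]; last first.
  by apply: claim1' => //; rewrite mem_filter negb_and negbK; apply/orP; left; apply/asboolP.
apply: contrapT => nIj.
have jw : j \in w by rewrite mem_filter mem_iota /= jN andbT; apply/asboolP.
move: h wN sw uw; case/splitPr: jw => w1 w2 h.
rewrite all_cat size_cat cat_uniq /= => /and3P[w1N _ w2N] sw /and3P[_ /norP[jw1 _] /andP[jw2 _]].
(* If [j] occurs in the product and the product keeps [o] close to itself, then so does [g j]: go
   from the image of [a j] under [act w1] to that of [o] under the whole product, then to [o], then
   to the image of [o] under [act w1]. *)
apply: nex; exists j => //.
have [cr cs ct] := ch j jN; have [gaut go] := gP j jN.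
have aut1 := act_aut w1 w1N.
have P1 := Pact w1 w1N.
have P1j : P (act w1 \o a j) by apply/(type_definable_aut _ P_tdef aut1); apply: Pa.
have Px : P (act (w1 ++ j :: w2) \o o) by apply: Pact; rewrite all_cat w1N /= w2N andbT.
have q1 := claim1' w1 j w1N jN jw1 ltac:(lia).
have q2 : instance (tau (l + 2)) (c j (l + 2)) (act (w1 ++ j :: w2) \o o) (act w1 \o a j).
  rewrite act_cat -go; apply/(instance_aut _ _ (g j \o (act w2 \o o)) (g j \o o) aut1).
  apply/(instance_aut _ _ (act w2 \o o) o gaut).
  by apply: claim1' => //; lia.
rewrite addn2 in h q1 q2.
apply/(instance_aut _ _ _ _ aut1); apply: (ct _ _ o) => //.
  by apply: (ct _ _ (act (w1 ++ j :: w2) \o o)) => //; apply: cs.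
by apply: (ct _ _ o) => //; [exact: cr|exact: cs].
Qed.

End Chains.

Section ChainExists.
Variables (K : Type) (L : language) (C C' : structure L) (iota : C -> C') (X : Type).
Hypotheses (mon : monster_over K iota) (X_small : small K X).
Variable P : set (X -> C').
Hypothesis P_tdef : type_definable iota P.

(** Entourages are halved repeatedly; the first one lies in [F] on [P] already, by reflexivity of
    [E]. *)
Lemma chain_exists E F : equivalence_on P E -> type_definable2 iota E ->
  definable iota F -> (forall a b, E a b -> F (copair a b)) ->
  exists tau c, [/\ chain iota P tau c, forall a b, E a b -> chain_rel iota P tau c a b &
    forall a b, P a -> P b -> instance iota (tau 0) (c 0) a b -> F (copair a b)].
Proof.
move=> eqE tE dF EF; have [EP Er Es Et] := eqE.
pose T := (formula L ((X + X) + nat) * (nat -> C))%type.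
pose sub (t : T) := forall a b, E a b -> instance iota t.1 t.2 a b.
pose sym (t : T) := forall a b, instance iota t.1 t.2 a b -> instance iota t.1 t.2 b a.
have [th0 [c0 [sub0 sym0 half0]]] := half_entourage mon X_small P_tdef eqE tE dF EF.
have /choice[next nextP] : forall t : T, exists t' : T, sub t -> [/\ sub t', sym t' &
    forall a b d, P a -> P b -> P d -> instance iota t'.1 t'.2 a b ->
      instance iota t'.1 t'.2 b d -> instance iota t.1 t.2 a d].
  move=> t; have [st|nst] := pselect (sub t); last by exists t.
  have [a b ab|th [c [h1 h2 h3]]] := half_entourage mon X_small P_tdef eqE tE
    (definable_instance iota t.1 t.2 inl inr) (F := [set u : X + X -> C' | instance iota t.1 t.2 (u \o inl) (u \o inr)]).
    exact: st.
  by exists (th, c).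
pose s k := iter k next (th0, c0).
have sP k : sub (s k) /\ sym (s k).
  elim: k => [|k [h1 h2]]; first by [].
  by have [] := nextP _ h1.
exists (fun k => (s k).1), (fun k => (s k).2); split.
- split=> [k a Pa|k a b Pa Pb|k a b d Pa Pb Pd].
  + by apply: (sP k).1; apply: Er.
  + exact: (sP k).2.
  + by have [_ _] := nextP _ (sP k).1; apply.
- by move=> a b ab; have [Pa Pb] := EP _ _ ab; split=> // k; apply: (sP k).1.
- by move=> a b Pa Pb ab; apply: (half0 a b b) => //; apply: sub0; apply: Er.
Qed.

End ChainExists.

(** * Domination *)

Lemma pigeonhole A B (h : A -> B) : ~ embeds A (B * nat) ->
  exists b, exists2 g : nat -> A, injective g & forall n, h (g n) = b.
Proof.
move=> nA; apply: contrapT => nb; apply: nA.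
have /choice[e eP] : forall b, exists e : A -> nat, forall x y, h x = b -> h y = b -> e x = e y -> x = y.
  move=> b; case: (embeds_total nat {x | h x = b}) => [[g gi]|[e ei]].
    exfalso; apply: nb; exists b, (fun n => sval (g n)); last by move=> n; case: (g n).
    move=> n m nm; apply: gi; case: (g n) (g m) nm => x xb [y yb] /= xy.
    by subst y; congr exist; apply: Prop_irrelevance.
  exists (fun x => if pselect (h x = b) is left p then e (exist _ x p) else 0) => x y xb yb.
  by case: pselect => // p; case: pselect => // q /ei[].
by exists (fun x => (h x, e (h x) x)) => x y [hxy]; rewrite -hxy; apply: eP.
Qed.

Lemma increasing_subsequence W (lt : W -> W -> Prop) (g : nat -> W) :
  well_founded lt -> (forall x y z, lt x y -> lt y z -> lt x z) ->
  (forall x y, [\/ lt x y, x = y | lt y x]) -> injective g ->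
  exists s : nat -> nat, forall k l, (k < l)%N -> lt (g (s k)) (g (s l)).
Proof.
move=> wf tr tri gi.
(* [t m] is the index of the least value of [g] from [m] on. *)
have /choice[t tP] : forall m, exists k, (m <= k)%N /\ forall j, (m <= j)%N -> ~ lt (g j) (g k).
  move=> m; apply: contrapT => nk.
  suff : forall x k, g k = x -> (m <= k)%N -> False by move=> /(_ _ m erefl (leqnn m)).
  elim/(well_founded_ind wf) => x IH k kx mk; apply: nk; exists k; split=> // j mj ljk.
  by apply: (IH (g j) _ j) => //; rewrite -kx.
pose s := fix s n := if n is m.+1 then t (s m).+1 else t 0.
have s_ge n : exists2 m, (m <= s n)%N & forall j, (m <= j)%N -> ~ lt (g j) (g (s n)).
  by case: n => [|n] /=; [have [] := tP 0; exists 0|have [] := tP (s n).+1; exists (s n).+1].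
have s_step n : lt (g (s n)) (g (s n.+1)).
  have [m ms mP] := s_ge n; have [sn _] := tP (s n).+1.
  have /mP h : (m <= s n.+1)%N by apply: leq_trans ms _; apply: ltnW.
  case: (tri (g (s n)) (g (s n.+1))) => // /gi e.
  by move: sn; rewrite -[t _]/(s n.+1) -e ltnn.
exists s => k l; elim: l => // l IH; rewrite ltnS leq_eqVlt => /predU1P[->|/IH h]; first exact: s_step.
exact: tr h (s_step l).
Qed.

Section Domination.
Variables (K : Type) (L : language) (C C' : structure L) (iota : C -> C') (X : Type).
Hypotheses (mon : monster_over K iota) (X_small : small K X).
Variable P : set (X -> C').
Hypotheses (P_tdef : type_definable iota P) (P_complete : forall a b, P a -> P b -> tp_eq iota a b).
Variable tau : nat -> formula L ((X + X) + nat).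

Let no_shatter (theta : formula L ((X + X) + nat)) N : Prop :=
  forall (d : nat -> nat -> C') (alpha : set nat -> X + X -> C'),
    ~ forall i I, (i < N)%N -> (sat (copair (alpha I) (d i)) theta <-> I i).

(** In an indiscernible sequence extracted from [(a n, o, c n, d n)], either
    all the [a i] are close to [o] for the entourages of the [c j] with
    [j != i], which NIP excludes, or the order between the [a i] and the [c j]
    is visible modulo [F], which stability excludes. *)
Lemma stable_no_order (F : (X -> C') -> (X -> C') -> Prop) (M : set (X + X -> C'))
  (chi : formula L (X + nat)) (d : nat -> nat -> C) (c : nat -> nat -> nat -> C)
  (a : nat -> X -> C') (o : X -> C') N :
  no_shatter (tau 2) N -> rep_stable K iota P F -> definable iota M ->
  (forall x y, F x y -> M (copair x y)) -> (forall n, chain iota P tau (c n)) ->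
  P o -> (forall n, P (a n)) ->
  (forall i j, (j < i)%N -> chain_rel iota P tau (c j) (a i) o) ->
  (forall n x, P x -> sat (copair x (iota \o d n)) chi) ->
  (forall n x x' y, sat (copair x (iota \o d n)) chi -> sat (copair x' (iota \o d n)) chi ->
     sat (copair y (iota \o d n)) chi -> M (copair x' x) ->
     instance iota (tau (2 + N).+1) (c n (2 + N).+1) x' y ->
     instance iota (tau (2 + N)) (c n (2 + N)) x y) ->
  exists i, instance iota (tau 0) (c i 0) (a i) o.
Proof.
move=> nip sF dM FM ch Po Pa ord Pchi dom.
have [_ _ _ sn _] := mon.
pose Y := (X + (nat + (nat + nat)))%type.
have sY : small K Y by do 3 !(apply: (monster_sum mon) => //).
(* All parameters are part of the sequence, as the extraction may move them out of C; what is known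
   about them has to be expressed by the formulas of [dom]. *)
pose u n : X + Y -> C' := copair (a n) (copair o (copair (iota \o c n (2 + N).+1)
  (copair (iota \o c n (2 + N)) (iota \o d n)))).
have [v rv vP] := extract_type_definable mon u (monster_sum mon X_small sY).
pose pair3 i j (w : nat * (X + Y) -> C') (s : (X + X) + nat) : C' := match s with
  | inl (inl x) => w (i, inl x) | inl (inr x) => w (j, inr (inl x))
  | inr k => w (j, inr (inr (inl k))) end.
pose pair2 i j (w : nat * (X + Y) -> C') (s : (X + X) + nat) : C' := match s with
  | inl (inl x) => w (i, inl x) | inl (inr x) => w (j, inr (inl x))
  | inr k => w (j, inr (inr (inr (inl k)))) end.
pose pairx i j (w : nat * (X + Y) -> C') (s : X + nat) : C' := match s with
  | inl x => w (i, inl x) | inr k => w (j, inr (inr (inr (inr k)))) end.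
pose A3 i j := [set w | sat (pair3 i j w) (tau (2 + N).+1)].
pose A2 i j := [set w | sat (pair2 i j w) (tau (2 + N))].
pose Ax i j := [set w | sat (pairx i j w) chi].
have dsat V (theta : formula L V) W (f : V -> W) :
    definable iota [set w : W -> C' | sat (w \o f) theta].
  exists (rename (inl \o f) theta) => w; rewrite sat_rename; exact: iff_of_eq.
have dA2 i j : definable iota (A2 i j).
  have := dsat _ (tau (2 + N)) _ (fun s : (X + X) + nat => match s with
    | inl (inl x) => (i, inl x) | inl (inr x) => (j, inr (inl x))
    | inr k => (j, inr (inr (inr (inl k)))) end : nat * (X + Y)).
  apply: definable_ext => w; apply: iff_of_eq; congr sat; by apply/funext => -[[]|].
have dA3 i j : definable iota (A3 i j).
  have := dsat _ (tau (2 + N).+1) _ (fun s : (X + X) + nat => match s with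
    | inl (inl x) => (i, inl x) | inl (inr x) => (j, inr (inl x))
    | inr k => (j, inr (inr (inl k))) end : nat * (X + Y)).
  apply: definable_ext => w; apply: iff_of_eq; congr sat; by apply/funext => -[[]|].
have dAx i j : definable iota (Ax i j).
  have := dsat _ chi _ (fun s : X + nat => match s with
    | inl x => (i, inl x) | inr k => (j, inr (inr (inr (inr k)))) end : nat * (X + Y)).
  apply: definable_ext => w; apply: iff_of_eq; congr sat; by apply/funext => -[].
have A3u s i j : A3 i j (env (u \o s)) <->
    instance iota (tau (2 + N).+1) (c (s j) (2 + N).+1) (a (s i)) o.
  by apply: iff_of_eq; congr sat; apply/funext => -[[]|].
have A2u s i j : A2 i j (env (u \o s)) <->
    instance iota (tau (2 + N)) (c (s j) (2 + N)) (a (s i)) o.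
  by apply: iff_of_eq; congr sat; apply/funext => -[[]|].
have Axu s i j : Ax i j (env (u \o s)) <-> sat (copair (a (s i)) (iota \o d (s j))) chi.
  by apply: iff_of_eq; congr sat; apply/funext => -[].
have Pv i : P (v i \o inl).
  have := vP [set w : nat * (X + Y) -> C' | P (w \o (fun x : X => (i, inl x)))].
  apply; first exact: (type_definable_preim (r := fun x : X => (i, inl x) : nat * (X + Y)) P_tdef).
  by move=> s _; exact: (Pa (s i)).
have [sigma aut [sF1 sF2]] := sF Y v sY Pv rv.
have v3 : A3 1 0 (env v).
  apply: vP; first exact: type_definable_defi.
  by move=> s si; apply/A3u; have [_ _] := ord _ _ (si 0 1 isT); apply.
have vx : Ax 1 0 (env v).
  by apply: vP => [|s si]; [exact: type_definable_defi|apply/Axu; apply: Pchi].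
(* The hypotheses of [dom] on [x'], with the point of term 0 as [x] and the parameters of term 1.
   That such a point implies [A2 0 1] is definable and passes to [v]. *)
pose B := [set w : X + nat * (X + Y) -> C' | M (copair (w \o inl) (fun x => w (inr (0, inl x)))) /\
  sat (copair (copair (w \o inl) (fun x => w (inr (1, inr (inl x)))))
     (fun k => w (inr (1, inr (inr (inl k)))))) (tau (2 + N).+1) /\
  sat (copair (w \o inl) (fun k => w (inr (1, inr (inr (inr (inr k))))))) chi].
have dB : definable iota B.
  apply: definable_and; last apply: definable_and.
  - have := definable_preim (copair inl (fun x => inr (0, inl x)) : X + X -> X + nat * (X + Y)) dM.
    by apply: definable_ext => w; apply: iff_of_eq; congr M; apply/funext => -[].
  - have := dsat _ (tau (2 + N).+1) _ (fun s : (X + X) + nat => match s with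
      | inl (inl x) => inl x | inl (inr x) => inr (1, inr (inl x))
      | inr k => inr (1, inr (inr (inl k))) end : X + nat * (X + Y)).
    by apply: definable_ext => w; apply: iff_of_eq; congr sat; apply/funext => -[[]|].
  - have := dsat _ chi _ (fun s : X + nat => match s with
      | inl x => inl x | inr k => inr (1, inr (inr (inr (inr k)))) end : X + nat * (X + Y)).
    by apply: definable_ext => w; apply: iff_of_eq; congr sat; apply/funext => -[].
have v2 : A2 0 1 (env v).
  have := vP [set w | (exists x, B (copair x w)) -> A2 0 1 w]; apply.
  - by apply: type_definable_defi; apply: definable_imp => //; apply: definable_ex.
  - move=> s si [x [Mx [x3 xx]]]; apply/A2u.
    apply: (dom (s 1) (a (s 0)) x o); [exact: Pchi| |exact: Pchi| |].
    + by move: xx; congr sat; apply/funext => -[].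
    + by move: Mx; congr M; apply/funext => -[].
    + by move: x3; rewrite /instance; congr sat; apply/funext => -[[]|].
  (* [sigma] takes the point of term 1 next to that of term 0, and the parameters of term 0 to those
     of term 1; it turns [A3 1 0] into closeness for the parameters of term 1. *)
  exists (sigma \o (v 1 \o inl)); split; [|split].
  - by move: (FM _ _ sF1); congr M; apply/funext => -[].
  - move: v3; rewrite /A3 /mkset -(sat_automorphism _ _ aut.1).
    congr sat; apply/funext => -[[x|x]|k] //=; first exact: (congr1 (@^~ (inl x)) sF2).
    exact: (congr1 (@^~ (inr (inl k))) sF2).
  - move: vx; rewrite /Ax /mkset -(sat_automorphism _ _ aut.1).
    congr sat; apply/funext => -[x|k] //=; exact: (congr1 (@^~ (inr (inr (inr k)))) sF2).
have {}v2 i j : (i < j)%N -> A2 i j (env v).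
  move=> ij; pose h k := if k is k'.+1 then (j + k')%N else i.
  have hi : incr h by move=> [|k] [|l] //=; lia.
  have := rv _ h (dA2 0 1) hi v2.
  by congr sat; apply/funext => -[[]|] //= x; rewrite /env /= addn0.
(* Return to the given sequence, where the chain conditions hold: if no [s] worked, the failure
   would be a definable property of all subsequences and so of [v]. *)
have [s [si sA2]] : exists s, incr s /\
    forall i j, (i < j)%N -> (j < N)%N -> A2 i j (env (u \o s)).
  apply: contrapT => ns.
  pose D := [set w | forall ij : nat * nat, List.In ij (allpairs pair (seq.iota 0 N) (seq.iota 0 N)) ->
     [set w | (ij.1 < ij.2)%N -> A2 ij.1 ij.2 w] w].
  have dD : definable iota D.
    apply: definable_all_seq => ij _; case: (ij.1 < ij.2)%N.
      by apply: definable_ext (dA2 ij.1 ij.2) => w; split=> [h _|/(_ isT)].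
    by apply: definable_ext (definable_true _ _) => w; split=> //.
  have Dv : D (env v) by move=> [i j] _; apply: v2.
  have : [set w | ~ D w] (env v).
    apply: vP; first by apply: type_definable_defi; apply: definable_not.
    move=> s si Ds; apply: ns; exists s; split=> // i j ij jN.
    have := Ds (i, j); apply=> //; apply/In_mem/allpairs_f; rewrite mem_iota //.
    by rewrite /= add0n (ltn_trans ij).
  exact.
have [||||i iN iP] := @independent_bound K L C C' iota X mon X_small P P_tdef tau P_complete 0 N
  (fun i => c (s i)) (fun i => a (s i)) o nip.
- by move=> i _; apply: ch.
- by [].
- by move=> i _; apply: Pa.
- move=> i j iN jN ij; rewrite !add0n.
  have [lt|lt|e] := ltngtP i j; last by rewrite e eqxx in ij.
    by apply/A2u; apply: sA2.
  by have [_ _] := ord _ _ (si _ _ lt); apply.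
by exists (s i).
Qed.

(** On [P], points related by all chains in [s] are close for [c], so the closeness of [x'] to [y]
    passes to [x] with the loss of one level. By compactness finitely many levels and a definable
    set containing [P] suffice for this. *)
Lemma domination_formula (s : seq (nat -> nat -> C)) (c : nat -> nat -> C) l :
  (forall e, List.In e s -> chain iota P tau e) -> chain iota P tau c ->
  (forall a b, P a -> P b -> (forall e, List.In e s -> chain_rel iota P tau e a b) ->
     instance iota (tau l.+1) (c l.+1) a b) ->
  exists (kchi : nat * formula L (X + nat)) (d : nat -> C),
    (forall x, P x -> sat (copair x (iota \o d)) kchi.2) /\
    (forall x x' y, sat (copair x (iota \o d)) kchi.2 -> sat (copair x' (iota \o d)) kchi.2 ->
     sat (copair y (iota \o d)) kchi.2 ->
     (forall e, List.In e s -> forall j, List.In j (seq.iota 0 kchi.1) ->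
        instance iota (tau j) (e j) x' x) ->
     instance iota (tau l.+1) (c l.+1) x' y -> instance iota (tau l) (c l) x y).
Proof.
move=> sch [cr cs ct] dom.
pose J := {G : set (X -> C') | definable iota G /\ P `<=` G}.
pose x1 : X -> X + (X + X) := inl.
pose x2 : X -> X + (X + X) := inr \o inl.
pose x3 : X -> X + (X + X) := inr \o inr.
pose D (o : J + nat) := [set u : X + (X + X) -> C' | match o with
  | inl G => sval G (u \o x1) /\ sval G (u \o x2) /\ sval G (u \o x3)
  | inr j => forall e, List.In e s -> instance iota (tau j) (e j) (u \o x2) (u \o x1) end].
have [o||u uD|q qP] := @type_definable_compact_sub K L C C' iota mon (J + nat)%type _ D
  [set u : X + (X + X) -> C' | instance iota (tau l.+1) (c l.+1) (u \o x2) (u \o x3) ->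
     instance iota (tau l) (c l) (u \o x1) (u \o x3)]
  (monster_sum mon X_small (monster_sum mon X_small X_small)).
- apply: type_definable_defi; case: o => [[G [dG PG]]|j].
    by apply: definable_and; last apply: definable_and; [exact: (definable_preim x1)|exact: (definable_preim x2)|
      exact: (definable_preim x3)].
  apply: (definable_all_seq (F := fun e => [set u : X + (X + X) -> C' | instance iota (tau j) (e j) (u \o x2) (u \o x1)])).
  by move=> e _; apply: definable_instance.
- by apply: definable_imp; apply: definable_instance.
- have uG (G : set (X -> C')) : definable iota G -> P `<=` G ->
      G (u \o x1) /\ G (u \o x2) /\ G (u \o x3).
    by move=> dG PG; exact: (uD (inl (exist _ G (conj dG PG)))).
  have P1 : P (u \o x1) by apply: P_tdef => G dG PG; have [] := uG G dG PG.
  have P2 : P (u \o x2) by apply: P_tdef => G dG PG; have [_ []] := uG G dG PG.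
  have P3 : P (u \o x3) by apply: P_tdef => G dG PG; have [_ []] := uG G dG PG.
  move=> h; apply: (ct _ _ (u \o x2)) => //; apply: cs => //; apply: dom => // e es.
  by split=> // j; apply: (uD (inr j)).
pose G := [set x | forall o, List.In o q -> (if o is inl G then sval G else [set _ | True]) x].
have [chi [d chiP]] : exists (theta : formula L (X + nat)) (c : nat -> C),
    forall u, G u <-> sat (copair u (iota \o c)) theta.
  apply: definable_template; apply: definable_all_seq => -[[H [dH PH]]|j] // _; apply: definable_true.
have [k kP] : exists k, forall j, List.In (inr j) q -> (j < k)%N.
  elim: q {qP G chiP} => [|o q [k kP]]; first by exists 0.
  exists (maxn k (if o is inr j then j.+1 else 0)) => j /= [->|/kP jk]; lia.
exists (k, chi), d; split=> [x Px|x x' y /chiP Gx /chiP Gx' /chiP Gy M xy].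
  by apply/chiP => -[[H [dH PH]]|j] //= _; apply: PH.
have := qP (copair x (copair x' y)); apply=> // -[H|j] jq /=.
  by split; [exact: (Gx (inl H))|split; [exact: (Gx' (inl H))|exact: (Gy (inl H))]].
move=> e es; apply: M => //; apply/In_mem; rewrite mem_iota /=; exact: kP.
Qed.

(** The [N3]-fold power set of [Lam] is large enough for a free sequence of length [N3], and it
    embeds into [Z], so the chains chosen before any stage are never too many for another choice. *)
Lemma domination (Z Lam : Type) :
  seq_closed Lam -> embeds (nat * formula L (X + nat) * nat) Lam ->
  (forall n, embeds (pset n Lam) Z) -> (forall theta, exists N, no_shatter theta N) ->
  let good c := chain iota P tau c /\ rep_stable K iota P (chain_rel iota P tau c) in
  exists D : set (nat -> nat -> C), [/\ embeds (set_type D) Z, D `<=` good &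
    forall c, good c -> forall a b, P a -> P b ->
      (forall e, D e -> chain_rel iota P tau e a b) -> instance iota (tau 0) (c 0) a b].
Proof.
move=> Lam_closed Lam_ge LamZ shatter good; apply: contrapT => nD.
have {}nD D : embeds (set_type D) Z -> D `<=` good -> exists c a b, [/\ good c, P a, P b,
    forall e, D e -> chain_rel iota P tau e a b & ~ instance iota (tau 0) (c 0) a b].
  move=> DZ Dg; apply: contrapT => nc; apply: nD; exists D; split=> // c gc a b Pa Pb h.
  by apply: contrapT => ni; apply: nc; exists c, a, b.
(* The failure of the empty set provides default values and the base point [o], to which the second
   point of each later pair is moved. *)
have [c0 [_ [o [_ _ Po _ _]]]] := nD set0 ltac:(by exists (fun x : set_type set0 =>
  False_rect Z (set_mem (valP x))) => -[x xP]; case: (set_mem xP)) (@sub0set _ _).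
have move_o b : P b -> exists2 g, automorphism_over iota g & g \o b = o.
  by move=> Pb; apply: (tp_eq_conj mon X_small (P_complete Pb Po)).
have {}nD D : exists ca : (nat -> nat -> C) * (X -> C'), embeds (set_type D) Z -> D `<=` good ->
    [/\ good ca.1, P ca.2, forall e, D e -> chain_rel iota P tau e ca.2 o &
        ~ instance iota (tau 0) (ca.1 0) ca.2 o].
  have [DZ|] := pselect (embeds (set_type D) Z); last by exists (c0, o).
  have [Dg|] := pselect (D `<=` good); last by exists (c0, o).
  have [c [a [b [gc Pa Pb h ni]]]] := nD D DZ Dg; have [g aut gb] := move_o b Pb.
  exists (c, g \o a) => _ _; split=> //=; first exact/(type_definable_aut _ P_tdef aut).
    move=> e De; have [_ _ hi] := h e De; split=> //; first exact/(type_definable_aut _ P_tdef aut).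
    by move=> k; rewrite -gb; apply/instance_aut.
  by rewrite -gb => /(instance_aut _ _ _ _ aut).
have /choice[pick pickP] := nD.
(* [stable_no_order] needs the level 2 + N0, and [domination_formula] loses one; so control is
   required at [l.+1], and [N3] is the bound that [independent_bound] needs there. *)
have [N0 N0P] := shatter (tau 2); pose l := (2 + N0)%N.
have [N3 N3P] := shatter (tau (l.+1 + 2)).
pose W := pset N3 Lam; have [lt [wf lt_tr lt_tri]] := well_order_exists W.
pose step (w : W) (rec : forall v, lt v w -> (nat -> nat -> C) * (X -> C')) :=
  pick [set c | exists v (h : lt v w), c = (rec v h).1].
pose ca := Fix wf (fun _ => ((nat -> nat -> C) * (X -> C'))%type) step.
have caE w : ca w = pick [set c | exists2 v, lt v w & c = (ca v).1].
  rewrite {1}/ca Fix_eq.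
    congr pick; apply/seteqP; split=> [c [v [h ->]]|c [v h ->]]; first by exists v.
    by exists v, h.
  move=> w' f g fg; rewrite /step; congr pick; apply/seteqP; split=> c [v [h ->]];
  by exists v, h; rewrite fg.
pose prev w := [set c | exists2 v, lt v w & c = (ca v).1].
have prevZ w : embeds (set_type (prev w)) Z.
  apply: embeds_trans (LamZ N3).
  have /choice[h hP] : forall c : prev w, exists v, val c = (ca v).1.
    by move=> [c cP]; have [v _ cv] := set_mem cP; exists v.
  by exists h => x y xy; apply: val_inj; rewrite !hP xy.
have caP w : [/\ good (ca w).1, P (ca w).2,
    forall v, lt v w -> chain_rel iota P tau (ca v).1 (ca w).2 o &
    ~ instance iota (tau 0) ((ca w).1 0) (ca w).2 o].
  elim/(well_founded_ind wf): w => w IH.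
  have [|g1 g2 g3 g4] := pickP (prev w) (prevZ w).
    by move=> _ [v vw ->]; have [] := IH v vw.
  by rewrite (caE w); split=> // v vw; apply: g3; exists v.
(* The indices controlled by [s]. If all these sets embedded into [Lam], a free sequence would be an
   independent family of size [N3]. *)
pose f (s : seq W) := [set w | forall a b, P a -> P b ->
  (forall e, List.In e (map (fun v => (ca v).1) s) -> chain_rel iota P tau e a b) ->
  instance iota (tau l.+1) ((ca w).1 l.+1) a b].
have [s fs] : exists s, ~ embeds (set_type (f s)) Lam.
  apply: contrapT => ns.
  have [s|xs [sxs xsf]] := @free_seq Lam N3 W id f Lam_closed (fun _ _ => id).
    by apply: contrapT => h; apply: ns; exists s.
  (* [N3] is positive, since the condition that [no_shatter] forbids is vacuously true for 0. *)
  have [w0 _] : exists w0 : W, True.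
    case: xs sxs {xsf} => [N30|w0 _ _]; last by exists w0.
    exfalso; have := N3P (fun _ _ => iota (c0 0 0)) (fun _ _ => iota (c0 0 0)).
    by apply=> i I; rewrite -N30 ltn0.
  pose x i := nth w0 xs i.
  have In_nth (r : seq W) j : (j < size r)%N -> List.In (nth w0 r j) r.
    by elim: r j => //= y r IH [|j] jr; [left|right; apply: IH].
  have /choice[ia iaP] : forall i, exists ia, (i < N3)%N -> [/\ P ia,
      forall j, (j < N3)%N -> i != j -> chain_rel iota P tau (ca (x j)).1 ia o &
      ~ instance iota (tau l.+1) ((ca (x i)).1 l.+1) ia o].
    move=> i; have [iN|] := pselect (i < N3)%N; last by exists o.
    apply: contrapT => nia.
    have xsE : xs = take i xs ++ x i :: drop i.+1 xs.
      by rewrite -drop_nth ?cat_take_drop // sxs.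
    apply: (xsf _ _ _ xsE) => a b Pa Pb h; apply: contrapT => ni; apply: nia.
    have [g aut gb] := move_o b Pb; exists (g \o a) => _.
    have Pga : P (g \o a) by apply/(type_definable_aut _ P_tdef aut).
    split=> // [j jN ij|]; last by rewrite -gb => /(instance_aut _ _ _ _ aut).
    have [_ _ hj] : chain_rel iota P tau (ca (x j)).1 a b.
      apply: h; apply/List.in_map_iff; exists (x j); split=> //.
      apply/List.in_app_iff.
      have [ji|lij|e] := ltngtP j i; last by rewrite e eqxx in ij.
        left; have -> : x j = nth w0 (take i xs) j by rewrite nth_take.
        by apply: In_nth; rewrite size_take sxs iN.
      right; have -> : x j = nth w0 (drop i.+1 xs) (j - i.+1) by rewrite nth_drop subnKC.
      by apply: In_nth; rewrite size_drop sxs ltn_sub2r // (leq_ltn_trans lij).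
    by split=> // k; rewrite -gb; apply/instance_aut.
  have [||||i iN] := @independent_bound K L C C' iota X mon X_small P P_tdef tau P_complete
    l.+1 N3 (fun i => (ca (x i)).1) ia o N3P.
  - by move=> i _; have [[]] := caP (x i).
  - by [].
  - by move=> i /iaP[].
  - by move=> i j iN jN ij; have [_ /(_ j jN ij)[_ _ h] _] := iaP i iN; apply: h.
  by have [_ _] := iaP i iN; apply.
pose es := map (fun v => (ca v).1) s.
have es_good e : List.In e es -> good e.
  by move=> /List.in_map_iff[v [<- _]]; have [] := caP v.
have /choice[kd kdP] : forall w : f s, exists kd : (nat * formula L (X + nat)) * (nat -> C),
    (forall x, P x -> sat (copair x (iota \o kd.2)) kd.1.2) /\
    (forall x x' y, sat (copair x (iota \o kd.2)) kd.1.2 ->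
     sat (copair x' (iota \o kd.2)) kd.1.2 -> sat (copair y (iota \o kd.2)) kd.1.2 ->
     (forall e, List.In e es -> forall j, List.In j (seq.iota 0 kd.1.1) ->
        instance iota (tau j) (e j) x' x) ->
     instance iota (tau l.+1) ((ca (val w)).1 l.+1) x' y ->
     instance iota (tau l) ((ca (val w)).1 l) x y).
  move=> [w ws] /=; have [[ch _] _ _ _] := caP w.
  have [|kchi [d dP]] := @domination_formula es (ca w).1 l _ ch (set_mem ws).
    by move=> e /es_good[].
  by exists (kchi, d).
(* [f s] is too large for [Lam], so infinitely many controlled indices share [k] and [chi]; only the
   parameters of [chi] vary. *)
have [|[k chi] [g gi gE]] := @pigeonhole _ _ (fun w => (kd w).1).
  by move=> h; apply: fs; apply: embeds_trans h Lam_ge.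
have [t tP] := increasing_subsequence wf lt_tr lt_tri (inj_comp val_inj gi).
pose w n := val (g (t n)).
pose F := bigcap_rel P (fun e : {e | List.In e es} => chain_rel iota P tau (sval e)).
pose M := [set u : X + X -> C' | forall e, List.In e es ->
  [set u : X + X -> C' | forall j, List.In j (seq.iota 0 k) ->
     [set u : X + X -> C' | instance iota (tau j) (e j) (u \o inl) (u \o inr)] u] u].
have := @stable_no_order F M chi (fun n => (kd (g (t n))).2) (fun n => (ca (w n)).1)
  (fun n => (ca (w n)).2) o N0 N0P.
case.
- apply: rep_stable_bigcap => // -[e /es_good[ch sc]] //=; first exact: chain_equivalence.
  exact: chain_type_definable2.
- by apply: definable_all_seq => e _; apply: definable_all_seq => j _; apply: definable_instance.
- by move=> a b [Pa Pb h] e ees j _; have [_ _] := h (exist _ e ees); apply.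
- by move=> n; have [[]] := caP (w n).
- by [].
- by move=> n; have [] := caP (w n).
- by move=> i j /tP ji; have [_ _ h _] := caP (w i); apply: h.
- by move=> n a Pa; have [+ _] := kdP (g (t n)); rewrite gE; apply.
- move=> n a a' b; have [_ +] := kdP (g (t n)); rewrite gE => h h1 h2 h3 Maa h4.
  by apply: (h a a' b).
by move=> i; have [_ _ _] := caP (w i).
Qed.

End Domination.

(** Finite trees with leaves in [A]: a node makes a sequence of trees into a tree, and trees are
    coded by words over nat + A. *)
Lemma below_pset_seq_closed S A : embeds nat S -> below_pset S A ->
  exists Lam, [/\ seq_closed Lam, embeds A Lam & below_pset S Lam].
Proof.
move=> natS bA; exists (GenTree.tree A); split.
- by exists (GenTree.Node 0) => s t [].
- by exists (@GenTree.Leaf A) => x y [].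
have le B D : embeds B D -> below_pset S D -> below_pset S B.
  by move=> BD [n Dn]; exists n; apply: embeds_trans BD Dn.
have bset B : below_pset S B -> below_pset S (set B).
  by move=> [n Bn]; exists n.+1; apply: embeds_set.
have bnat : below_pset S nat by exists 0.
apply: (le _ (seq (nat + A))).
  by exists (@GenTree.encode A); apply: pcan_inj (@GenTree.codeK A).
apply: ideal_seq => //; first exact: below_pset_dir.
by apply: ideal_sum => //; exact: below_pset_dir.
Qed.

Theorem theorem4p18
  (L : language) (T : set (sentence L))
  (T_complete : complete_theory T) (T_infinite : has_infinite_model T)
  (T_NIP : NIP T)
  (* the cardinals kappa = |K| and kappa' = |K'| *)
  (K K' : Type)
  (K_strong_limit : strong_limit K) (K'_strong_limit : strong_limit K')
  (* the models C and C', with the inclusion iota of C in C' *)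
  (C C' : structure L) (iota : C -> C')
  (C_model : models C T) (C'_model : models C' T)
  (iota_elementary : elementary_embedding iota)
  (K_gt_T : card_lt [set: sentence L] [set: K])
  (C_saturated : saturated K C)
  (K'_gt_C : card_lt [set: C] [set: K'])
  (C'_saturated : saturated K' C')
  (C'_homogeneous : strongly_homogeneous K' C')
  (A : set C) (A_small : card_lt A [set: K])
  (X : Type) (X_small : card_lt [set: X] [set: K])
  (p : set (formula L (X + C)))
  (p_type : complete_type p) (p_invariant : invariant_over A p)
  (K_large : beth_succ_le (set (set (X + sentence L + set_type A))) K) :
  exists Est : (X -> C') -> (X -> C') -> Prop,
    stable_equivalence iota K K' (realizations iota p) Est /\
    forall E : (X -> C') -> (X -> C') -> Prop,
      stable_equivalence iota K K' (realizations iota p) E ->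
      forall a b, Est a b -> E a b.
Proof.
have sent_small : small K (sentence L) by apply/card_ltTE.
have nat_small := small_le (embeds_nat_sentence L) sent_small.
have XK : small K X by apply/card_ltTE.
(* Since kappa is at most |C|, which is less than kappa', smallness passes from [K] to [K']. *)
have KC := saturated_card C_saturated (complete_theory_infinite T_complete T_infinite C_model).
have CK' : small K' C by apply/card_ltTE.
have XK' : small K' X := small_le (embeds_trans XK.1 KC) CK'.
have natK' : small K' nat := small_le (embeds_trans nat_small.1 KC) CK'.
have mon : monster_over K' iota by [].
have K_set := @small_set K K_strong_limit.
have K_dir := @small_dir K.
have K_le := @small_le K.
have K_prod B D := @ideal_prod _ K_le K_set K_dir B D.
have K_seq B := @ideal_seq _ K_le K_set K_dir nat_small B.
have K_sum B D := @ideal_sum _ K_le K_set K_dir B D.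
pose S := (X + sentence L + set_type A)%type.
have natS : embeds nat S.
  apply: embeds_trans (embeds_nat_sentence L) _.
  by exists (fun phi => inl (inr phi)) => phi psi [].
have [Z [SZ ZK]] := beth_strong_limit natS K_large.
have Z_small : small K Z.
  split; first exact: embeds_trans (embeds_set1 _) ZK.
  by move=> KZ; apply: (@cantor Z); apply: embeds_trans ZK KZ.
have [Lam [Lam_closed Lam_ge [m LamS]]] :
    exists Lam, [/\ seq_closed Lam, embeds (nat * formula L (X + nat) * nat) Lam & below_pset S Lam].
  apply: below_pset_seq_closed => //.
  have le B D : embeds B D -> below_pset S D -> below_pset S B.
    by move=> BD [n Dn]; exists n; apply: embeds_trans BD Dn.
  have bset B : below_pset S B -> below_pset S (set B).
    by move=> [n Bn]; exists n.+1; apply: embeds_set.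
  have bnat : below_pset S nat by exists 0.
  have bdir := @below_pset_dir S.
  have bprod B D := @ideal_prod _ le bset bdir B D.
  apply: (bprod (nat * formula L (X + nat))%type nat) => //.
  apply: (bprod nat (formula L (X + nat))) => //; apply: (le _ _ (embeds_formula _ _)).
  apply: (bprod).
    by exists 0 => /=; exists (fun phi => inl (inr phi)) => phi psi [].
  apply: ideal_seq => //; apply: ideal_sum => //.
  by exists 0 => /=; exists (fun x => inl (inl x)) => x y [].
have LamZ n : embeds (pset n Lam) Z.
  apply: embeds_trans (SZ (n + m)); elim: n => [//|n IH]; exact: embeds_set IH.
set P := realizations iota p.
have P_tdef : type_definable iota P.
  move=> a aP phi pphi.
  by apply: (aP [set u | sat (copair u iota) phi]) => [|u /(_ _ pphi)//]; exists phi.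
have P_complete a b : P a -> P b -> tp_eq iota a b.
  move=> Pa Pb D [phi phiP] /phiP sa; apply/phiP.
  by case: (p_type.2 phi) => [/Pb|/Pa /(_ sa)].
have shatter (theta : formula L ((X + X) + nat)) : exists N, forall (d : nat -> nat -> C')
    (alpha : set nat -> X + X -> C'),
    ~ forall i I, (i < N)%N -> (sat (copair (alpha I) (d i)) theta <-> I i).
  apply: (NIP_bound _ T_NIP C'_model C'_saturated K'_strong_limit natK').
  exact: (monster_sum mon).
(* [Z] is the same for all shapes, so the chains selected for all of them together are still fewer
   than kappa. *)
have /choice[D DP] : forall tau, _ := fun tau =>
  @domination K' L C C' iota X mon XK' P P_tdef P_complete tau Z Lam Lam_closed Lam_ge LamZ shatter.
pose I := {tc : (nat -> formula L ((X + X) + nat)) * (nat -> nat -> C) | D tc.1 tc.2}.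
pose rel (i : I) := chain_rel iota P (sval i).1 (sval i).2.
have Igood i : chain iota P (sval i).1 (sval i).2 /\ rep_stable K' iota P (rel i).
  by case: i => [[tau c] Dc]; have [_ Dg _] := DP tau; exact: (Dg _ Dc).
have eq_rel i : equivalence_on P (rel i) by apply: chain_equivalence; have [] := Igood i.
have type_definable_rel i : type_definable2 iota (rel i) by apply: chain_type_definable2.
exists (bigcap_rel P rel); split.
  split; first exact: equivalence_bigcap.
    pose B := [set m | exists (i : I) j k, m = (sval i).2 j k].
    exists B; split.
      apply/card_ltE; pose th := formula L ((X + X) + nat).
      have th_small : small K th.
        apply: K_le (embeds_formula _ _) _; apply: (K_prod) => //; apply: (K_seq).
        by apply: (K_sum) => //; apply: (K_sum).
      have seqs_small : small K (nat -> th).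
        apply: (K_le _ (set (nat * th))); last by apply: (K_set); apply: (K_prod).
        exists (fun f => [set kt | f kt.1 = kt.2]) => f g /seteqP[fg _].
        by apply/funext => k; apply: esym; apply: (fg (k, f k)).
      (* A parameter is determined by a shape, the code in [Z] of a chain of that shape, and a
         position in the chain. *)
      have /K_le : embeds B ((nat -> th) * Z * (nat * nat)); last first.
        by apply; apply: (K_prod); apply: (K_prod).
      have DZ tau : embeds (set_type (D tau)) Z by have [] := DP tau.
      pose code tau := projT1 (cid (DZ tau)).
      have codeP tau : injective (code tau) := projT2 (cid (DZ tau)).
      have /choice[h hP] : forall b : B, exists s : I * (nat * nat),
          val b = (sval s.1).2 s.2.1 s.2.2.
        by move=> [b bB]; have [i [j [k bE]]] := set_mem bB; exists (i, (j, k)).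
      exists (fun b => ((sval (h b).1).1, code (sval (h b).1).1
        (exist _ (sval (h b).1).2 (mem_set (svalP (h b).1))), (h b).2)) => b b' hh.
      apply: val_inj; rewrite !hP; move: hh.
      case: (h b) (h b') => [[[tau c] Dc] jk] [[[tau' c'] Dc'] jk'] /= [tt].
      by subst tau'; move=> /codeP[<-] <-.
    exists [set phi | exists (i : I) j, phi = rename (fun s => match s with
      | inl x => inl x
      | inr k => inr (exist _ ((sval i).2 j k) (mem_set (ex_intro _ i (ex_intro _ j
          (ex_intro _ k erefl)) : B ((sval i).2 j k)))) end) ((sval i).1 j)].
    have instE i j a b : sat (copair (copair a b) (iota \o set_val)) (rename (fun s => match s with
      | inl x => inl x
      | inr k => inr (exist _ ((sval i).2 j k) (mem_set (ex_intro _ i (ex_intro _ j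
          (ex_intro _ k erefl)) : B ((sval i).2 j k)))) end) ((sval i).1 j)) <->
        instance iota ((sval i).1 j) ((sval i).2 j) a b.
      by rewrite sat_rename; apply: iff_of_eq; congr sat; apply/funext => -[].
    move=> a b; split=> [[Pa Pb h]|[Pa Pb h]]; split=> //.
      by move=> _ [i [j ->]]; apply/instE; have [_ _] := h i; apply.
    by move=> i; split=> // j; apply/instE; apply: h; exists i, j.
  apply: rep_stable_stable_quotient => //.
  - exact: equivalence_bigcap.
  - exact: type_definable2_bigcap.
  - by apply: rep_stable_bigcap => // i; have [] := Igood i.
move=> E [eqE [B [_ Bdef]] sE] a b [Pa Pb ab].
have tE := rel_type_definable_type_definable P_tdef Bdef.
have rE := stable_quotient_rep_stable mon XK' eqE tE sE.
have [pi piE] := Bdef; apply/piE; split=> // phi pphi.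
pose F := [set u : X + X -> C' | sat (copair u (iota \o set_val)) phi].
have dF : definable iota F.
  exists (rename (fun s : (X + X) + set_type B => match s with inl x => inl x
    | inr b => inr (set_val b) end) phi) => u.
  by rewrite sat_rename; apply: iff_of_eq; congr sat; apply/funext => -[].
have EF x y : E x y -> F (copair x y) by move=> /piE[_ _]; apply.
(* On [P], the set [F] contains the first entourage of a chain whose relation is coarser than [E],
   hence stable; domination for the shape of this chain applies to it. *)
have [tau [c [ch Ec cF]]] := chain_exists mon XK' P_tdef eqE tE dF EF.
apply: (cF a b Pa Pb); have [_ _] := DP tau; apply=> //.
  by split=> //; apply: rep_stable_coarser rE.
move=> e De; exact: (ab (exist _ (tau, e) De)).
Qed.
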